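(* Let $r\ge2$ be fixed. Let $G$ be an $r$-uniform $r$-partite hypergraph with $n$ vertices in each class which satisfies the properties $I(r,n,d)$ and $D(r,n,d)$, where $1\le d\le n^{r-1}$. Then $$\chi_l(G)=(g(r,\alpha)+o(1))\log_r d,$$ where $\alpha=\log_n d$ and the $o(1)$ term is a quantity (depending only on $r$ and $d$) tending to zero as $d\to\infty$.
   Context: Hypergraph setting: vertex set $V=V_1\cup\cdots\cup V_r$, disjoint classes of size $n$, each edge contains exactly one vertex of each $V_i$. For $X\subseteq V$, $X_i=X\cap V_i$ and $i_X=\min\{i:|X_i|=\max_j|X_j|\}$. $X$ is independent if it contains no edge; $X$ is $k$-degenerate if every nonempty $Y\subseteq X$ induces a subhypergraph $G[Y]$ with a vertex of degree at most $k$. $G$ has property $I(r,n,d)$ if every independent $X$ satisfies $\prod_{i\ne i_X}|X_i|<\frac{n^{r-1}}{d}\log^2 d$; $G$ has property $D(r,n,d)$ if every $X$ with $\prod_{i\ne i_X}|X_i|<\frac{n^{r-1}}{d}$ is $(4\log d/\log\log d)$-degenerate ($\log$ natural). List colouring: given lists $L(v)$ of colours, $G$ is $L$-chooseable if one can pick $c(v)\in L(v)$ for all $v$ with no edge all of whose vertices get the same colour; $\chi_l(G)$ is the least $k$ such that $G$ is $L$-chooseable whenever $|L(v)|\ge k$ for all $v$. The function $g$: For a total order $<$ on $[m]=\{1,\dots,m\}$ and $k\in[m]$, the relative position ${\rm rpos}_<(k)$ is $\frac1m|\{j\in[m]: j\le k \text{ in } <\}|$. An $(r,m)$-preference order is an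 $r$-tuple $P=(<_1,\dots,<_r)$ of total orders on $[m]$; write $x\in P$ if $x=({\rm rpos}_{<_1}(k),\dots,{\rm rpos}_{<_r}(k))$ for some $k\in[m]$. For $x\in[0,1]^r$ let $i_x=\min\{i:x_i=\max_j x_j\}$. For $0\le\theta\le1/r$ let $f_P(\theta)=\max\{\prod_{i\ne i_x}x_i: x\in P,\ x\in[\theta,1]^r\}$, $f(r,\theta,m)=\min\{f_P(\theta): P \text{ an }(r,m)\text{-preference order}\}$ and $f(r,\theta)=\inf_{m\in\mathbb N}f(r,\theta,m)$. For $0<\alpha\le r-1$ let $\beta(\alpha)$ be the solution $\theta\in[0,1/r]$ of $\theta^\alpha=f(r,\theta)$ (formally $\beta(\alpha)=\sup\{\theta\in[0,1/r]:\theta^\alpha\le f(r,\theta)\}$), and $g(r,\alpha)=-1/\log_r f(r,\beta(\alpha))$. The function $g(r,\cdot)$ is constant on $(0,1]$, and $g(r,0)$ is defined to be this constant value. *)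

(* Defs.v *)
From mathcomp Require Import all_boot all_order all_algebra.
From mathcomp Require Import finmap.
From mathcomp Require Import all_classical all_reals all_analysis.

Set Implicit Arguments.
Unset Strict Implicit.
Unset Printing Implicit Defensive.

Import Order.TTheory GRing.Theory Num.Theory.
Import numFieldNormedType.Exports.

Local Open Scope ring_scope.

(* [is_first_max x i] holds for exactly one index when 0 < r, namely the least
   i at which x attains its maximum (i_X and i_x in the literature). *)
Definition is_max (R : realType) (r : nat) (x : 'I_r -> R) (i : 'I_r) : bool :=
  [forall j, x j <= x i].

Definition is_first_max (R : realType) (r : nat) (x : 'I_r -> R) (i : 'I_r) :
    bool :=
  is_max x i && [forall j, is_max x j ==> (i <= j)%N].

Definition prod_but_max (R : realType) (r : nat) (x : 'I_r -> R) : R :=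
  \prod_(i < r | ~~ is_first_max x i) x i.

(* Edges meet each class in exactly one vertex, so the hypergraph is r-uniform. *)
Record partite_hypergraph (r n : nat) := PartiteHypergraph {
  vertex :> finType;
  class_of : vertex -> 'I_r;
  edges : {set {set vertex}};
  card_class : forall i, #|[set v | class_of v == i]| = n;
  edge_transversal : forall e, e \in edges ->
    forall i, #|[set v in e | class_of v == i]| = 1%N
}.

Section Hypergraph.
Variables (r n : nat) (G : partite_hypergraph r n).

Definition class_part (X : {set G}) (i : 'I_r) : {set G} :=
  [set v in X | class_of v == i].

Definition independent (X : {set G}) : Prop :=
  forall e, e \in edges G -> ~~ (e \subset X).

Definition induced_degree (Y : {set G}) (v : G) : nat :=
  #|[set e in edges G | (e \subset Y) && (v \in e)]|.

Definition degenerate (R : realType) (k : R) (X : {set G}) : Prop :=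
  forall Y : {set G}, Y \subset X -> Y != finset.set0 ->
    exists2 v, v \in Y & (induced_degree Y v)%:R <= k.

Definition size_prod (R : realType) (X : {set G}) : R :=
  prod_but_max (fun i => #|class_part X i|%:R).

Definition property_I (R : realType) (d : R) : Prop :=
  forall X : {set G}, independent X ->
    size_prod R X < n%:R ^+ r.-1 / d * ln d ^+ 2.

Definition property_D (R : realType) (d : R) : Prop :=
  forall X : {set G}, size_prod R X < n%:R ^+ r.-1 / d ->
    degenerate (4 * ln d / ln (ln d)) X.

Definition list_colourable (C : choiceType) (L : G -> {fset C}) : Prop :=
  exists c : G -> C, (forall v, c v \in L v) /\
    (forall e, e \in edges G -> ~ exists a, forall v, v \in e -> c v = a).

Definition choosable (k : nat) : Prop :=
  forall (C : choiceType) (L : G -> {fset C}),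
    (forall v, (k <= #|` L v|)%N) -> list_colourable L.

Definition is_list_chromatic_number (k : nat) : Prop :=
  choosable k /\ forall k', choosable k' -> (k <= k')%N.

(* The default value 0 is not used when 2 <= r: see
   [list_chromatic_numberP] below. *)
Definition list_chromatic_number : nat :=
  xget 0%N [set k | is_list_chromatic_number k]%classic.

Lemma injective_choice (C : choiceType) (L : G -> {fset C}) (s : seq G) :
  uniq s -> (forall v, (0 < #|` L v|)%N) ->
  (forall v, (size s <= #|` L v|)%N) ->
  exists c : G -> C, (forall v, c v \in L v) /\ {in s &, injective c}.
Proof.
move=> us L0; elim: s us => [_ _|x s IHs /= /andP[xs us] sL].
  have /choice[c cL] : forall v, exists a, a \in L v.
    by move=> v; apply/fset0Pn; rewrite -cardfs_gt0.
  by exists c.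
have [c [cL cinj]] := IHs us (fun v => ltnW (sL v)).
have [a aL ac] : exists2 a, a \in L x & a \notin [seq c v | v <- s].
  apply: contrapT => noa; have := sL x; apply/negP; rewrite -ltnNge ltnS.
  rewrite -(size_map c s); apply: uniq_leq_size (fset_uniq _) _ => a aL.
  by apply: contrapT => /negP ac; apply: noa; exists a.
exists (fun v => if v == x then a else c v); split=> [v|u v].
  by case: eqP => [->|].
rewrite !inE; case: (u =P x) => [->|_] /=; case: (v =P x) => [->|_] //=.
- by move=> _ vs ea; move: ac; rewrite ea map_f.
- by move=> us' _ ea; move: ac; rewrite -ea map_f.
- exact: cinj.
Qed.

Lemma choosable_card : (1 < r)%N -> choosable #|G|.
Proof.
move=> r1 C L cardL.
have L0 v : (0 < #|` L v|)%N.
  by apply: leq_trans (cardL v); apply/card_gt0P; exists v.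
have [|c [cL cinj]] := @injective_choice C L (enum G) (enum_uniq G) L0.
  by move=> v; rewrite -cardE.
exists c; split=> // e eE [a ea].
have r0 := ltnW r1.
have /eqP/cards1P[u eu] := edge_transversal eE (Ordinal r0).
have /eqP/cards1P[v ev] := edge_transversal eE (Ordinal r1).
have /setIdP[ue /eqP cu] : u \in [set v in e | class_of v == Ordinal r0].
  by rewrite eu inE.
have /setIdP[ve /eqP cv] : v \in [set v in e | class_of v == Ordinal r1].
  by rewrite ev inE.
have uv : u = v by apply: cinj; rewrite ?mem_enum // !ea.
by move: cv; rewrite -uv cu => /(congr1 val).
Qed.

Lemma list_chromatic_numberP :
  (1 < r)%N -> is_list_chromatic_number list_chromatic_number.
Proof.
move=> r1; apply: (@xgetPex _ 0%N [set k | is_list_chromatic_number k]%classic).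
have ex : exists k, `[< choosable k >].
  by exists #|G|; apply/asboolP/choosable_card.
case: (ex_minnP ex) => k /asboolP ck kmin.
by exists k; split=> // k' /asboolP/kmin.
Qed.

End Hypergraph.

(* A total order on [m] is represented by its non-strict relation. *)
Definition total_order (m : nat) (le : rel 'I_m) : Prop :=
  [/\ antisymmetric le, transitive le & total le].

Definition preference_order (r m : nat) (P : 'I_r -> rel 'I_m) : Prop :=
  forall i, total_order (P i).

Section PreferenceFunction.
Variables (R : realType) (r : nat).

Definition rpos (m : nat) (le : rel 'I_m) (k : 'I_m) : R :=
  #|[set j | le j k]|%:R / m%:R.

(* For theta <= 1/r the range of this maximum is nonempty, and its terms are
   nonnegative, so the initial value 0 plays no role. *)
Definition f_pref (m : nat) (P : 'I_r -> rel 'I_m) (theta : R) : R :=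
  \big[Num.max/0]_(k < m | [forall i, theta <= rpos (P i) k])
    prod_but_max (fun i => rpos (P i) k).

(* There are finitely many preference orders for each m, so this infimum is
   attained. *)
Definition f_size (theta : R) (m : nat) : R :=
  inf [set f_pref P theta | P in
         [set P : 'I_r -> rel 'I_m | preference_order P]]%classic.

Definition f_inf (theta : R) : R :=
  inf [set f_size theta m | m in [set m | (0 < m)%N]]%classic.

Definition beta (alpha : R) : R :=
  sup [set theta | 0 <= theta <= r%:R^-1 /\ theta `^ alpha <= f_inf theta]%classic.

Definition log_base (b x : R) : R := ln x / ln b.

Definition g_pos (alpha : R) : R := - (log_base r%:R (f_inf (beta alpha)))^-1.

(* [g_pos] is constant on ]0, 1]; at 0 we take that constant value. *)
Definition g_pref (alpha : R) : R :=
  if alpha == 0 then g_pos 1 else g_pos alpha.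

End PreferenceFunction.

(* Main.v *)
(* Write [f] for the preference function and [beta] for the crossing point, so
   that [beta^alpha = f beta].

   Upper bound. Fix a preference order [P] on [m] types nearly attaining
   [f beta], and give every colour a random type. A vertex of class [i] with a
   list of size [l] uses the [P i]-greatest type occurring at least [t] times in
   its list. A vertex of class [i] uses a type at or below [k] with probability
   at most [d^o(1) x_i^l], where [x_i] is the relative position of [k]; hence the
   vertices using type [k] number at most [n d^o(1) x_i^l] in class [i]. As soon
   as [l] exceeds [g log_r d] slightly, this is below 1 when [x_i < beta], and
   otherwise the product over the classes is below [n^(r-1)/d]. So the vertices
   using type [k] form a degenerate set, which is coloured greedily from the
   colours of type [k].

   Lower bound. Let the lists be random [l]-subsets of a palette of
   polylogarithmic size [M]: every palette subset of density [x] contains about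
   [n x^l] of the lists in each class. Given a colouring, order the palette in
   class [i] by the number of vertices of that class receiving each colour. The
   colour at relative position [x_i] occurs at least [n x_i^l / (8 M)] times in
   class [i], and some colour has all [x_i >= beta] and product at least
   [f beta]. If [l] is slightly less than [g log_r d], its colour class violates
   property [I]. *)
Require Import Defs.
From mathcomp Require Import all_boot all_order all_algebra.
From mathcomp Require Import finmap.
From mathcomp Require Import all_classical all_reals all_analysis.
From mathcomp Require Import lra.

Set Implicit Arguments.
Unset Strict Implicit.
Unset Printing Implicit Defensive.

Import Order.TTheory GRing.Theory Num.Theory.
Import numFieldNormedType.Exports.

Local Open Scope ring_scope.
(** * The product over all but a largest coordinate *)

Lemma first_max_exists (R : realType) (r : nat) (x : 'I_r -> R) :
  (0 < r)%N -> exists j, is_first_max x j /\ forall i, is_first_max x i = (i == j).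
Proof.
move=> r0.
have [j1 mj1] : exists j, is_max x j.
  pose j := [arg max_(i > Ordinal r0) x i]%O.
  exists j; apply/forallP => k; rewrite /j; case: arg_maxP => // i _ /(_ k isT).
  exact.
have [j mj jmin] : exists2 j, is_max x j & forall k, is_max x k -> (j <= k)%N.
  case: (@arg_minnP _ j1 (is_max x) (fun i => nat_of_ord i) mj1) => j mj jm.
  by exists j.
exists j.
have fj : is_first_max x j.
  by rewrite /is_first_max mj; apply/forallP => k; apply/implyP/jmin.
split=> // i; apply/idP/eqP => [/andP[mi /forallP im]|->//].
apply/val_inj/eqP; rewrite eqn_leq jmin // andbT.
by have /implyP := im j; apply.
Qed.

Lemma prod_but_max_argmax (R : realType) (r : nat) (x : 'I_r -> R) :
  (0 < r)%N ->
  exists2 j, is_max x j & prod_but_max x = \prod_(i < r | i != j) x i.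
Proof.
move=> /(first_max_exists x)[j [/andP[mj _] je]]; exists j => //.
by apply: eq_bigl => i; rewrite je.
Qed.

(** The two products share all factors outside j and k, and there remains x j <= x k. So
    [prod_but_max] is the least of the r products omitting one coordinate. *)
Lemma prod_but_max_le (R : realType) (r : nat) (x : 'I_r -> R) (j : 'I_r) :
  (forall i, 0 <= x i) -> prod_but_max x <= \prod_(i < r | i != j) x i.
Proof.
move=> x0; have r0 : (0 < r)%N by apply: leq_ltn_trans (ltn_ord j).
have [k /forallP mk ->] := prod_but_max_argmax x r0.
have [->//|jk] := eqVneq j k.
rewrite (bigD1 j) //= [leRHS](bigD1 k) 1?eq_sym //=.
rewrite (eq_bigl (fun i => (i != j) && (i != k))) => [|i]; last by rewrite andbC.
by apply: ler_wpM2r; [exact: prodr_ge0 | exact: mk].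
Qed.

Lemma prod_but_max_ge0 (R : realType) (r : nat) (x : 'I_r -> R) :
  (forall i, 0 <= x i) -> 0 <= prod_but_max x.
Proof. by move=> x0; apply: prodr_ge0 => i _. Qed.

Lemma le_prod_but_max (R : realType) (r : nat) (x y : 'I_r -> R) :
  (forall i, 0 <= x i <= y i) -> prod_but_max x <= prod_but_max y.
Proof.
case: r x y => [x y _|r x y xy].
  by rewrite /prod_but_max !big1 // => -[].
have [k _ ->] := prod_but_max_argmax y isT.
apply: (le_trans (prod_but_max_le k _)) => [i|]; first by have /andP[] := xy i.
by apply: ler_prod => i _.
Qed.

Lemma prod_const_but_one (R : realType) (r : nat) (c : R) (j : 'I_r) :
  \prod_(i < r | i != j) c = c ^+ r.-1.
Proof. by rewrite prodr_const cardC1 card_ord. Qed.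

(** The first maximum may move under the map (for instance when l = 0). Each inequality therefore
    omits the coordinate that is maximal on one side and uses minimality on the other. *)
Lemma prod_but_max_scaleX (R : realType) (r : nat) (x : 'I_r -> R) (c : R)
    (l : nat) : (0 < r)%N -> 0 <= c -> (forall i, 0 <= x i) ->
  prod_but_max (fun i => c * x i ^+ l) = c ^+ r.-1 * prod_but_max x ^+ l.
Proof.
move=> r0 c0 x0.
have prodE j : \prod_(i < r | i != j) (c * x i ^+ l) =
    c ^+ r.-1 * (\prod_(i < r | i != j) x i) ^+ l.
  by rewrite big_split /= prod_const_but_one prodrXl.
have cx0 i : 0 <= c * x i ^+ l by rewrite mulr_ge0 // exprn_ge0.
apply/eqP; rewrite eq_le; apply/andP; split.
  have [k _ ->] := prod_but_max_argmax x r0.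
  by rewrite -prodE; exact: prod_but_max_le.
have [k _ ->] := prod_but_max_argmax (fun i => c * x i ^+ l) r0.
rewrite prodE ler_wpM2l ?exprn_ge0 //.
rewrite lerXn2r ?nnegrE ?prodr_ge0 ?prod_but_max_ge0 //.
exact: prod_but_max_le.
Qed.

Lemma prod_but_max_le_coord (R : realType) (r : nat) (x : 'I_r -> R) (j : 'I_r) :
  (1 < r)%N -> (forall i, 0 <= x i <= 1) -> prod_but_max x <= x j.
Proof.
move=> r1 x01; have x0 i : 0 <= x i by have /andP[] := x01 i.
have [k kj] : exists k : 'I_r, k != j.
  have : (0 < #|predC1 j|)%N by rewrite cardC1 card_ord -subn1 subn_gt0.
  by move=> /card_gt0P[k kj]; exists k.
apply: (le_trans (prod_but_max_le k x0)).
rewrite (bigD1 j) 1?eq_sym //= ler_piMr //.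
by apply: prodr_ile1 => i _.
Qed.

Lemma prod_but_max_eq0 (R : realType) (r : nat) (x : 'I_r -> R) (j : 'I_r) :
  (1 < r)%N -> (forall i, 0 <= x i) -> x j = 0 -> prod_but_max x = 0.
Proof.
move=> r1 x0 xj.
have [k kj] : exists k : 'I_r, k != j.
  have : (0 < #|predC1 j|)%N by rewrite cardC1 card_ord -subn1 subn_gt0.
  by move=> /card_gt0P[k kj]; exists k.
apply/eqP; rewrite eq_le prod_but_max_ge0 // andbT.
apply: (le_trans (prod_but_max_le k x0)).
by rewrite (bigD1 j) 1?eq_sym //= xj mul0r.
Qed.

(** * Preference orders and the function f *)

Definition linear_order (T : Type) (le : rel T) : Prop :=
  [/\ antisymmetric le, transitive le & total le].

(** The element of A with the largest down-set is its maximum: if j were not below h, totality would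
    put h below j, and the down-set of j would be strictly larger. *)
Lemma linear_order_max (T : finType) (le : rel T) (A : {pred T}) (j0 : T) :
  linear_order le -> j0 \in A ->
  exists2 h, h \in A & forall j, j \in A -> le j h.
Proof.
move=> [_ tr tot] j0A.
exists [arg max_(h > j0 in A) #|[set l | le l h]|]; case: arg_maxnP => // h hA hmax.
move=> j jA; apply: contraT => njh; have := hmax j jA; rewrite /= leqNgt => /negP[].
have hj : le h j by have := tot h j; rewrite (negbTE njh) orbF.
apply/proper_card/properP; split.
  by apply/fintype.subsetP => l; rewrite !inE => /tr; apply.
exists j; rewrite !inE //.
by have := tot j j; rewrite orbb.
Qed.

Lemma linear_order_key (T : Type) (key : T -> nat) :
  injective key -> linear_order (fun x y => key x <= key y)%N.
Proof.
move=> kinj; split=> [x y /anti_leq/kinj //|y x z|x y]; last exact: leq_total.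
exact: leq_trans.
Qed.

(** Serves both for consecutive copies of an element and for colours ranked by frequency. *)
Lemma linear_order_lex (T : Type) (U : eqType) (key : T -> U) (le : rel U)
    (tie : T -> T -> bool) :
  linear_order le -> (forall x y, key x = key y -> tie x y -> tie y x -> x = y) ->
  transitive tie -> total tie ->
  linear_order (fun x y => if key x == key y then tie x y else le (key x) (key y)).
Proof.
move=> [lea letr let_] tiea tietr tiet; split.
- move=> x y; rewrite [key y == key x]eq_sym; case: eqP => [e /andP[]|ne /lea] //.
  exact: tiea.
- move=> y x z; have [-> | nxy] := eqVneq (key x) (key y).
    by case: eqP => // _; exact: tietr.
  have [<- | nyz] := eqVneq (key y) (key z); first by rewrite (negbTE nxy).
  move=> lxy lyz; case: eqP => [xz|_]; last exact: letr lyz.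
  by move: lyz nxy; rewrite -xz => lyx; rewrite (lea (key x) (key y)) ?lxy ?eqxx.
- move=> x y; rewrite [key y == key x]eq_sym; case: eqP => _; last exact: let_.
  exact: tiet.
Qed.

Lemma rpos01 (R : realType) (m : nat) (le : rel 'I_m) (k : 'I_m) :
  0 <= rpos R le k <= 1.
Proof.
rewrite /rpos divr_ge0 ?ler0n //= ler_pdivrMr ?mul1r ?ltr0n.
  by rewrite ler_nat -[leqRHS]card_ord max_card.
exact: leq_ltn_trans (ltn_ord k).
Qed.

Lemma rpos_ge0 (R : realType) (m : nat) (le : rel 'I_m) (k : 'I_m) :
  0 <= rpos R le k.
Proof. by have /andP[] := rpos01 R le k. Qed.

Lemma rpos_mono (R : realType) (m : nat) (le : rel 'I_m) (j k : 'I_m) :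
  transitive le -> le j k -> rpos R le j <= rpos R le k.
Proof.
move=> tr jk; rewrite ler_wpM2r ?invr_ge0 ?ler0n // ler_nat subset_leq_card //.
by apply/fintype.subsetP => l; rewrite !inE => lj; apply: tr jk.
Qed.

(** The greatest element h of the set has the whole set below it, so the cardinality is at most m
    times the position of h. *)
Lemma rpos_below_card (R : realType) (m : nat) (le : rel 'I_m) (theta : R) :
  linear_order le -> 0 < theta -> (0 < m)%N ->
  #|[set j | rpos R le j < theta]|%:R < theta * m%:R.
Proof.
move=> lin th0 m0; have [_ tr _] := lin.
have [->|[j0 jA]] := set_0Vmem [set j | rpos R le j < theta].
  by rewrite cards0 mulr_gt0 ?ltr0n.
have [h hA hmax] := linear_order_max lin jA.
move: hA; rewrite inE /rpos ltr_pdivrMr ?ltr0n //; apply: le_lt_trans.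
rewrite ler_nat subset_leq_card //; apply/fintype.subsetP => l lA; rewrite inE.
exact: hmax.
Qed.

Lemma f_pref_ge (R : realType) (r m : nat) (P : 'I_r -> rel 'I_m) (theta : R)
    (k : 'I_m) : (forall i, theta <= rpos R (P i) k) ->
  prod_but_max (fun i => rpos R (P i) k) <= f_pref P theta.
Proof.
by move=> H; apply: (le_bigmax_cond 0 (fun k => prod_but_max (fun i => rpos R (P i) k)));
  apply/forallP.
Qed.

Lemma f_pref_ge0 (R : realType) (r m : nat) (P : 'I_r -> rel 'I_m) (theta : R) :
  0 <= f_pref P theta.
Proof. exact: bigmax_ge_id. Qed.

Lemma f_pref_antitone (R : realType) (r m : nat) (P : 'I_r -> rel 'I_m)
    (theta theta' : R) : theta <= theta' -> f_pref P theta' <= f_pref P theta.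
Proof.
move=> tt'; apply: sub_bigmax => k /forallP H; apply/forallP => i.
exact: le_trans tt' (H i).
Qed.

(** An index excluded by the threshold has a coordinate under theta, and every coordinate bounds the
    product. *)
Lemma f_pref0 (R : realType) (r m : nat) (P : 'I_r -> rel 'I_m) (theta : R) :
  (1 < r)%N -> 0 <= theta -> f_pref P 0 <= Num.max (f_pref P theta) theta.
Proof.
move=> r1 t0; apply: bigmax_le => [|k _]; first by rewrite le_max t0 orbT.
have [/forallP H|] := boolP [forall i, theta <= rpos R (P i) k].
  by rewrite le_max f_pref_ge.
rewrite negb_forall => /existsP[i]; rewrite -ltNge le_max => lti.
apply/orP; right; apply: le_trans (ltW lti).
by apply: (prod_but_max_le_coord i) => // j; exact: rpos01.
Qed.

(* Fewer than m/r indices have relative position below 1/r in a given order, so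
   some index has all its relative positions at least 1/r. *)
Lemma f_pref_lb (R : realType) (r m : nat) (P : 'I_r -> rel 'I_m) (theta : R) :
  (0 < r)%N -> (0 < m)%N -> preference_order P -> theta <= r%:R^-1 ->
  r%:R^-1 ^+ r.-1 <= f_pref P theta.
Proof.
move=> r0 m0 hP tr.
have rR : 0 < r%:R^-1 :> R by rewrite invr_gt0 ltr0n.
have [k hk] : exists k, forall i, r%:R^-1 <= rpos R (P i) k.
  pose A i := [set j | rpos R (P i) j < r%:R^-1].
  have : (#|\bigcup_i A i| < m)%N.
    rewrite -(ltr_nat R).
    apply: (@le_lt_trans _ _ (\sum_i #|A i|)%:R).
      rewrite ler_nat; apply: (big_ind2 (fun (X : {set 'I_m}) b => #|X| <= b)%N) => //.
        by rewrite cards0.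
      move=> X x Y y Xx Yy; apply: leq_trans (leq_add Xx Yy).
      by rewrite cardsU leq_subr.
    rewrite natr_sum.
    apply: (@lt_le_trans _ _ (\sum_(i < r) r%:R^-1 * m%:R)).
      apply: ltr_sum => [|i _]; last exact: (rpos_below_card (hP i)).
      by apply/hasP; exists (Ordinal r0) => //; rewrite mem_index_enum.
    rewrite sumr_const card_ord -[leLHS]mulr_natl mulrA mulfV ?mul1r //.
    by rewrite pnatr_eq0 -lt0n.
  rewrite -[ltnRHS](card_ord m) -cardsT => lt.
  have /existsP[k] : [exists k, k \notin \bigcup_i A i].
    rewrite -negb_forall; apply: contraL lt => /forallP H.
    by rewrite -leqNgt subset_leq_card //; apply/fintype.subsetP => k _; exact: H.
  move=> /bigcupP H; exists k => i; rewrite leNgt; apply/negP => lt'.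
  by apply: H; exists i => //; rewrite inE.
apply: le_trans (f_pref_ge (theta := theta) (k := k) _); last first.
  by move=> i; exact: le_trans (hk i).
have [j _ ->] := prod_but_max_argmax (fun i => rpos R (P i) k) r0.
rewrite -(prod_const_but_one _ j); apply: ler_prod => i _.
by rewrite (ltW rR) hk.
Qed.

Lemma preference_order_exists (r m : nat) :
  exists P : 'I_r -> rel 'I_m, preference_order P.
Proof.
exists (fun _ (x y : 'I_m) => x <= y)%N => i; exact: (linear_order_key val_inj).
Qed.

Lemma has_inf_f_size (R : realType) (r m : nat) (theta : R) :
  has_inf [set f_pref P theta | P in
         [set P : 'I_r -> rel 'I_m | preference_order P]]%classic.
Proof.
have [P hP] := preference_order_exists r m; split.
  by exists (f_pref P theta), P.
by exists 0 => _ [Q _ <-]; exact: f_pref_ge0.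
Qed.

Lemma has_inf_f_inf (R : realType) (r : nat) (theta : R) :
  has_inf [set f_size r theta m | m in [set m | (0 < m)%N]]%classic.
Proof.
split; first by exists (f_size r theta 1), 1%N.
exists 0 => _ [m _ <-]; apply: lb_le_inf; first by have [] := has_inf_f_size r m theta.
by move=> _ [Q _ <-]; exact: f_pref_ge0.
Qed.

Lemma f_inf_le_pref (R : realType) (r m : nat) (P : 'I_r -> rel 'I_m)
    (theta : R) : (0 < m)%N -> preference_order P ->
  f_inf r theta <= f_pref P theta.
Proof.
move=> m0 hP; apply: (@le_trans _ _ (f_size r theta m)).
  by apply: ge_inf; [have [] := has_inf_f_inf r theta | exists m].
by apply: ge_inf; [have [] := has_inf_f_size r m theta | exists P].
Qed.

Lemma f_inf_approx (R : realType) (r : nat) (theta c : R) :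
  f_inf r theta < c ->
  exists m (P : 'I_r -> rel 'I_m),
    [/\ (0 < m)%N, preference_order P & f_pref P theta < c].
Proof.
move=> fc; have c0 : 0 < c - f_inf r theta by rewrite subr_gt0.
have [_ [m m0 <-]] := inf_adherent c0 (has_inf_f_inf r theta).
rewrite -/(f_inf r theta) subrKC => mc.
have c1 : 0 < c - f_size r theta m by rewrite subr_gt0.
have [_ [P hP <-]] := inf_adherent c1 (has_inf_f_size r m theta).
by rewrite -/(f_size r theta m) subrKC => Pc; exists m, P.
Qed.

Lemma f_inf_ge (R : realType) (r : nat) (theta c : R) :
  (forall m (P : 'I_r -> rel 'I_m), (0 < m)%N -> preference_order P ->
    c <= f_pref P theta) -> c <= f_inf r theta.
Proof.
move=> H; rewrite leNgt; apply/negP => /f_inf_approx[m [P [m0 hP]]].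
by rewrite ltNge H.
Qed.

Lemma f_inf_lb (R : realType) (r : nat) (theta : R) :
  (0 < r)%N -> theta <= r%:R^-1 -> r%:R^-1 ^+ r.-1 <= f_inf r theta.
Proof. by move=> r0 tr; apply: f_inf_ge => m P m0 hP; exact: f_pref_lb. Qed.

Lemma f_inf_antitone (R : realType) (r : nat) (theta theta' : R) :
  theta <= theta' -> f_inf r theta' <= f_inf r theta.
Proof.
move=> tt'; apply: f_inf_ge => m P m0 hP.
exact: le_trans (f_inf_le_pref theta' m0 hP) (f_pref_antitone P tt').
Qed.

Lemma f_inf_le_finType (R : realType) (r : nat) (T : finType)
    (le : 'I_r -> rel T) (theta c : R) : (0 < #|T|)%N ->
  (forall i, linear_order (le i)) -> 0 <= c ->
  (forall k : T,
    let x i : R := #|[set j | le i j k]|%:R / #|T|%:R in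
    (forall i, theta <= x i) -> prod_but_max x <= c) ->
  f_inf r theta <= c.
Proof.
move=> T0 lin c0 H.
pose P i (a b : 'I_#|T|) := le i (enum_val a) (enum_val b).
have hP : preference_order P.
  move=> i; have [la lt lo] := lin i; split=> [a b /la /enum_val_inj //|a b d|a b].
    exact: lt.
  exact: lo.
apply: le_trans (f_inf_le_pref theta T0 hP) _.
have rE i k : rpos R (P i) k = #|[set j | le i j (enum_val k)]|%:R / #|T|%:R.
  rewrite /rpos; congr (_%:R / _); rewrite -(card_imset _ enum_val_inj).
  apply: eq_card => j; rewrite inE; apply/imsetP/idP => [[a]|jk].
    by rewrite inE => ? ->.
  by exists (enum_rank j); rewrite ?inE /P enum_rankK.
apply: bigmax_le => // k /forallP Hk.
apply: (le_trans _ (H (enum_val k) _)) => [|i]; last by have := Hk i; rewrite rE.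
by apply: le_prod_but_max => i /=; rewrite rpos_ge0 rE /=.
Qed.

(** * Blow-ups of orders and the variation of f in theta *)

Lemma card_sigma_tag (S : finType) (w : S -> nat) (Q : pred S) :
  #|[set p : {k : S & 'I_(w k)} | Q (tag p)]| = (\sum_(k | Q k) w k)%N.
Proof.
rewrite -sum1_card (eq_bigr (fun k => \sum_(a < w k) 1)%N) => [|k _]; last first.
  by rewrite sum1_card card_ord.
rewrite (@sig_big_dep _ _ _ _ (fun k => 'I_(w k)) Q (fun _ _ => true)
  (fun _ _ => 1%N)).
by apply: eq_bigl => p; rewrite inE andbT.
Qed.

(* Each k is replaced by w k consecutive copies. *)
Lemma f_inf_le_weighted (R : realType) (r : nat) (S : finType)
    (le : 'I_r -> rel S) (w : S -> nat) (theta c : R) :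
  (0 < \sum_k w k)%N -> (forall i, linear_order (le i)) -> 0 <= c ->
  (forall k : S,
    let x i : R := (\sum_(j | le i j k) w j)%:R / (\sum_j w j)%:R in
    (forall i, theta <= x i) -> prod_but_max x <= c) ->
  f_inf r theta <= c.
Proof.
move=> W0 lin c0 H.
pose T : finType := {k : S & 'I_(w k)}.
have cT : #|T| = (\sum_k w k)%N.
  by rewrite -(card_sigma_tag w predT) -cardsT; apply: eq_card => p; rewrite !inE.
pose tie (p q : T) := (tagged p <= tagged q)%N.
have tiea (p q : T) : tag p = tag q -> tie p q -> tie q p -> p = q.
  case: p q => [k a] [l b] /= kl; case: l / kl b => b ab ba.
  by congr existT; apply/val_inj/eqP; rewrite eqn_leq; apply/andP.
pose leT i (p q : T) := if tag p == tag q then tie p q else le i (tag p) (tag q).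
have linT i : linear_order (leT i).
  apply: linear_order_lex (lin i) tiea _ _ => [p q s|p q]; last exact: leq_total.
  exact: leq_trans.
apply: (f_inf_le_finType (le := leT)) => // [|q y Hy]; first by rewrite cT.
(* Copies of the label of q that come after q are counted on the right only, hence an inequality. *)
have yx i : 0 <= y i <= (\sum_(j | le i j (tag q)) w j)%:R / (\sum_j w j)%:R.
  rewrite /y divr_ge0 ?ler0n //= cT ler_wpM2r ?invr_ge0 ?ler0n // ler_nat.
  rewrite -card_sigma_tag subset_leq_card //; apply/fintype.subsetP => p.
  rewrite !inE /leT; case: eqP => [->|//] _.
  by have [_ _ t] := lin i; have := t (tag q) (tag q); rewrite orbb.
apply: le_trans (le_prod_but_max yx) (H (tag q) _) => i.
by apply: le_trans (Hy i) _; have /andP[] := yx i.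
Qed.

(** Given P, the indices with all positions at least theta get b + 1 copies and the others b. The
    former gain at most a factor 1 + 1/b in position, while the total grows by at least (1 - r
    theta) m, which pushes the others below the lowered threshold. As f is antitone, this yields its
    continuity below 1/r. *)
Lemma f_inf_shrink (R : realType) (r b : nat) (theta : R) :
  (1 < r)%N -> (0 < b)%N -> 0 < theta -> theta <= r%:R^-1 ->
  f_inf r (theta / (1 + (1 - r%:R * theta) / b%:R)) <=
    (1 + b%:R^-1) ^+ r.-1 * f_inf r theta.
Proof.
move=> r1 b0 t0 tr; have r0 := ltnW r1.
have bR : 0 < b%:R :> R by rewrite ltr0n.
have rR : 0 < r%:R :> R by rewrite ltr0n.
have K0 : 0 < (1 + b%:R^-1) ^+ r.-1 :> R.
  by rewrite exprn_gt0 // addr_gt0 // invr_gt0.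
rewrite [leRHS]mulrC -ler_pdivrMr //; apply: f_inf_ge => m P m0 hP.
rewrite ler_pdivrMr // [leRHS]mulrC.
have mR : 0 < m%:R :> R by rewrite ltr0n.
have rt : 0 <= 1 - r%:R * theta.
  by rewrite subr_ge0 mulrC -ler_pdivlMr // mul1r.
pose U := [set k | [forall i, theta <= rpos R (P i) k]].
pose w k := (b + (k \in U))%N.
have WE : (\sum_k w k = b * m + #|U|)%N.
  rewrite big_split /= sum_nat_const card_ord mulnC; congr (_ + _)%N.
  by rewrite -sum1_card [RHS]big_mkcond /=; apply: eq_bigr => k _; case: (k \in U).
(* At most r theta m indices lie outside U, by a union over the r orders. *)
have Ularge : (1 - r%:R * theta) * m%:R <= #|U|%:R.
  have : m%:R - #|U|%:R <= r%:R * (theta * m%:R) :> R; last lra.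
  have -> : m%:R - #|U|%:R = #|~: U|%:R :> R.
    have := cardsC U; rewrite card_ord => /(congr1 (fun k => k%:R : R)).
    by rewrite natrD; lra.
  apply: (@le_trans _ _ (\sum_(i < r) #|[set j | (rpos R (P i) j < theta)%R]|)%:R).
    rewrite ler_nat; apply: (@leq_trans #|\bigcup_(i < r) [set j | rpos R (P i) j < theta]|).
      rewrite subset_leq_card //; apply/fintype.subsetP => k.
      rewrite !inE negb_forall => /existsP[i]; rewrite -ltNge => ki.
      by apply/bigcupP; exists i => //; rewrite inE.
    apply: (big_ind2 (fun (X : {set 'I_m}) b => #|X| <= b)%N) => //.
      by rewrite cards0.
    move=> X x Y y Xx Yy; apply: leq_trans (leq_add Xx Yy).
    by rewrite cardsU leq_subr.
  have -> : r%:R * (theta * m%:R) = \sum_(i < r) theta * m%:R.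
    by rewrite sumr_const card_ord mulr_natl.
  rewrite natr_sum.
  apply: ler_sum => i _; apply/ltW; exact: (rpos_below_card (hP i)).
have W0 : (0 < \sum_k w k)%N by rewrite WE ltn_addr // muln_gt0 b0.
have bmW : b%:R * m%:R <= (\sum_k w k)%:R :> R.
  by rewrite WE -natrM ler_nat leq_addr.
have WR : 0 < (\sum_k w k)%:R :> R by rewrite ltr0n.
apply: (f_inf_le_weighted (le := P) (w := w)) => // [|k x Hx].
  by rewrite mulr_ge0 ?f_pref_ge0 // ltW.
have xE i : x i = (\sum_(j | P i j k) w j)%:R / (\sum_j w j)%:R by [].
have posE i : rpos R (P i) k * m%:R = #|[set j | P i j k]|%:R.
  by rewrite /rpos divfK // gt_eqF.
have [kU|] := boolP (k \in U).
  apply: (@le_trans _ _ (prod_but_max (fun i => (1 + b%:R^-1) * rpos R (P i) k ^+ 1))).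
    apply: le_prod_but_max => i; rewrite xE divr_ge0 ?ler0n //= expr1.
    rewrite ler_pdivrMr //.
    apply: (@le_trans _ _ ((b.+1)%:R * (rpos R (P i) k * m%:R))).
      rewrite posE -natrM ler_nat mulnC -sum_nat_cond_const.
      by apply: leq_sum => j _; rewrite /w -addn1 leq_add2l leq_b1.
    rewrite -addn1 natrD.
    have -> : (b%:R + 1) * (rpos R (P i) k * m%:R) =
        (1 + b%:R^-1) * rpos R (P i) k * (b%:R * m%:R).
      have bb : b%:R^-1 * b%:R = 1 :> R by rewrite mulVf // gt_eqF.
      have -> : (1 + b%:R^-1) * rpos R (P i) k * (b%:R * m%:R) =
        (b%:R + b%:R^-1 * b%:R) * (rpos R (P i) k * m%:R) by lra.
      by rewrite bb.
    by rewrite ler_wpM2l // mulr_ge0 ?rpos_ge0 //.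
  rewrite prod_but_max_scaleX ?expr1 //.
    rewrite ler_wpM2l // ?(ltW K0) // f_pref_ge //.
    by move: kU; rewrite inE => /forallP.
  by move=> i; exact: rpos_ge0.
(* Some order i has k below theta. Everything below k in that order is also outside U and has weight
   b, so the position of k shrinks by the whole growth of the total. *)
rewrite inE negb_forall => /existsP[i]; rewrite -ltNge => ki.
have := Hx i; rewrite leNgt => /negP[].
have [_ tr' _] := hP i.
have sumE : (\sum_(j | P i j k) w j = b * #|[set j | P i j k]|)%N.
  rewrite mulnC -sum_nat_cond_const.
  apply: eq_bigr => j jk; rewrite /w [j \in U]inE.
  suff -> : [forall i, theta <= rpos R (P i) j] = false by rewrite addn0.
  apply/negbTE; rewrite negb_forall; apply/existsP; exists i; rewrite -ltNge.
  exact: le_lt_trans (rpos_mono R tr' jk) ki.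
rewrite xE sumE natrM -posE ltr_pdivrMr //.
have D0 : 0 < 1 + (1 - r%:R * theta) / b%:R by rewrite ltr_pwDl // divr_ge0 // ltW.
rewrite [ltRHS]mulrAC ltr_pdivlMr //.
apply: (@lt_le_trans _ _ (theta * (b%:R * m%:R * (1 + (1 - r%:R * theta) / b%:R)))).
  rewrite [X in X < _](_ : _ = rpos R (P i) k * (b%:R * m%:R * (1 + (1 - r%:R * theta) / b%:R))).
    by rewrite ltr_pM2r // !mulr_gt0.
  by lra.
rewrite ler_pM2l // WE natrD natrM mulrDr mulr1 lerD2l.
apply: le_trans Ularge.
have bb : b%:R * b%:R^-1 = 1 :> R by rewrite mulfV // gt_eqF.
rewrite [leLHS](_ : _ = (b%:R * b%:R^-1) * ((1 - r%:R * theta) * m%:R)); last lra.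
by rewrite bb mul1r.
Qed.

Lemma sum_option (T : finType) (F : option T -> nat) :
  (\sum_k F k = F None + \sum_j F (Some j))%N.
Proof.
rewrite (bigD1 None) //= (reindex_omap Some id) => [|[]//].
by congr addn; apply: eq_bigl => j; rewrite eqxx.
Qed.

Lemma bernoulli (R : realDomainType) (x : R) (n : nat) :
  -1 <= x -> 1 + n%:R * x <= (1 + x) ^+ n.
Proof.
move=> x1; have x1' : 0 <= 1 + x by lra.
elim: n => [|n IHn]; first by rewrite mul0r addr0 expr0.
rewrite exprS; apply: le_trans (ler_wpM2l x1' IHn).
have xx : 0 <= n%:R * (x * x) :> R by rewrite mulr_ge0 ?ler0n // -expr2 sqr_ge0.
by rewrite -natr1; nra.
Qed.

Lemma exists_expr_le (R : realType) (q e : R) :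
  0 < q < 1 -> 0 < e -> exists j, q ^+ j <= e.
Proof.
move=> /andP[q0 q1] e0; have [qi ei] : 0 < q^-1 /\ 0 < e^-1 by rewrite !invr_gt0.
have d0 : 0 < q^-1 - 1 by rewrite subr_gt0 invf_gt1.
have h0 : 0 <= e^-1 / (q^-1 - 1) by rewrite divr_ge0 // ltW.
exists (Num.bound (e^-1 / (q^-1 - 1))); set j := Num.bound _.
have := archi_boundP h0; rewrite -/j ltr_pdivrMr // => hj.
have := @bernoulli R (q^-1 - 1) j; rewrite subrKC => /(_ _) B.
rewrite -lef_pV2 ?posrE ?exprn_gt0 // -exprVn.
by apply: le_trans (B _); lra.
Qed.

(** Follows from 1 + 1/b <= exp(1/b) with b > k / ln C. It fixes the number of copies in a blow-up
    whose cost must stay within C. *)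
Lemma exists_root_le (R : realType) (C : R) (k : nat) :
  1 < C -> exists2 b, (0 < b)%N & (1 + b%:R^-1) ^+ k <= C.
Proof.
move=> C1; have lC := ln_gt0 C1; have C0 : 0 < C by lra.
have h0 : 0 <= k%:R / ln C by rewrite divr_ge0 ?ler0n // ltW.
have := archi_boundP h0; set b := Num.bound _ => hb.
have b0 : (0 < b)%N by rewrite -(ltr_nat R) (le_lt_trans h0).
exists b => //; have bR : 0 < b%:R :> R by rewrite ltr0n.
apply: (@le_trans _ _ (expR (k%:R * b%:R^-1))).
  by rewrite expRM_natl lerXn2r ?nnegrE ?expR_ge0 // expR_ge1Dx.
rewrite -[leRHS](lnK (C0 : C \in Num.pos)) ler_expR.
by rewrite ler_pdivrMr // mulrC -ler_pdivrMr // ltW.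
Qed.

Lemma le_of_le_mul (R : realType) (x y : R) :
  0 < y -> (forall C, 1 < C -> x <= C * y) -> x <= y.
Proof.
move=> y0 H; rewrite leNgt; apply/negP => yx.
have C1 : 1 < (1 + x / y) / 2.
  have : 1 < x / y by rewrite ltr_pdivlMr // mul1r.
  lra.
have := H _ C1.
have -> : (1 + x / y) / 2 * y = (y + x / y * y) / 2 by lra.
by rewrite divfK ?gt_eqF //; lra.
Qed.

(* The extra element is second-lowest everywhere, while element i is lowest in
   the i-th order: after blowing up each i by s, all positions of the extra
   element are at most (s+1)/(rs+1). *)
Lemma f_inf_le_block (R : realType) (r s : nat) (theta c : R) :
  (1 < r)%N ->
  ((s%:R + 1) / (r%:R * s%:R + 1)) ^+ r.-1 <= c ->
  (theta <= s%:R / (r%:R * s%:R + 1) -> s%:R / (r%:R * s%:R + 1) <= c) ->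
  f_inf r theta <= c.
Proof.
move=> r1 c1 c2; have r0 := ltnW r1.
(* Order i gives rank 0 to [Some i] and rank 1 to the extra element [None]. *)
pose key (i : 'I_r) (k : option 'I_r) : nat :=
  if k is Some j then (if j == i then 0 else j.+2)%N else 1%N.
have keyI i : injective (key i).
  move=> [j|] [k|] //=; rewrite /key /=; do ?case: eqP => //.
  - by move=> -> ->.
  - by move=> _ _ [/val_inj ->].
pose w (k : option 'I_r) := if k is Some _ then s else 1%N.
have WE : (\sum_k w k = r * s + 1)%N.
  by rewrite sum_option /= addnC sum_nat_const card_ord.
have WR : (\sum_k w k)%:R = r%:R * s%:R + 1 :> R by rewrite WE natrD natrM.
have W0 : 0 < r%:R * s%:R + 1 :> R by rewrite ltr_wpDl // mulr_ge0.
have c0 : 0 <= c.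
  by apply: le_trans c1; rewrite exprn_ge0 // divr_ge0 ?addr_ge0 // ltW.
apply: (@f_inf_le_weighted _ _ _ (fun i x y => key i x <= key i y)%N w) => //.
- by rewrite WE addn1.
- by move=> i; exact: linear_order_key (keyI i).
(* A block k is either excluded by theta or bounded by its position in order k, where it is
   lowest. *)
move=> [k|] x Hx.
- have xk : x k = s%:R / (r%:R * s%:R + 1).
    rewrite /x WR; congr (_%:R / _); rewrite (big_pred1 (Some k)) // => -[j|] /=.
      rewrite eqxx; case: (eqVneq j k) => [->|jk]; first by rewrite eqxx.
      by apply/esym/negbTE; apply: contra_neq jk => -[].
    by rewrite eqxx.
  apply: (@le_trans _ _ (x k)); last by rewrite xk c2 // -xk.
  apply: prod_but_max_le_coord => // i; rewrite /x divr_ge0 ?ler0n //=.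
  rewrite ler_pdivrMr ?mul1r ?ler_nat; last by rewrite ltr0n WE addn1.
  by rewrite big_mkcond leq_sum // => j _; case: ifP.
- apply: le_trans c1.
  have [k _ ->] := prod_but_max_argmax x r0.
  rewrite -(prod_const_but_one _ k); apply: ler_prod => i _.
  rewrite /x divr_ge0 ?ler0n //= WR ler_wpM2r ?invr_ge0 ?(ltW W0) //.
  rewrite natr1 ler_nat big_mkcond sum_option /= (bigD1 i) //= eqxx /= big1 => [|j ji].
    by rewrite addn0 add1n.
  by rewrite (negbTE ji).
Qed.

(** Blocks of size 1 suffice. Keeping f away from 1 bounds -ln f below by ln (3/2), hence g
    above. *)
Lemma f_inf_ub (R : realType) (r : nat) (theta : R) :
  (1 < r)%N -> f_inf r theta <= 2 / 3.
Proof.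
move=> r1; have rR : 2 <= r%:R :> R by rewrite ler_nat.
have Wi : (r%:R + 1)^-1 <= 3^-1 :> R by rewrite lef_pV2 ?posrE; lra.
have Wi0 : 0 <= (r%:R + 1)^-1 :> R by rewrite invr_ge0; lra.
apply: (@f_inf_le_block _ _ 1) => // [|_]; rewrite mulr1; last by lra.
case: r r1 rR Wi Wi0 => [|[|r]] // _ _ Wi Wi0; rewrite /= exprS.
apply: (@le_trans _ _ ((1 + 1) / (r.+2%:R + 1))); last by lra.
by apply: ler_piMr; rewrite ?exprn_ile1 //; lra.
Qed.

(** At 1/r the shrinking argument gives nothing, since 1 - r theta vanishes. Instead, a threshold
    between s/(rs + 1) and 1/r excludes all blocks, and for large s the product at the extra element
    approaches the lower bound r^-(r-1). *)
Lemma f_inf_near_max (R : realType) (r : nat) (C : R) : (1 < r)%N -> 1 < C ->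
  exists2 t : R, 0 < t < r%:R^-1 &
    forall theta, t <= theta -> f_inf r theta <= C * r%:R^-1 ^+ r.-1.
Proof.
move=> r1 C1; have [s s0 sC] := exists_root_le r.-1 C1.
have rR : 1 < r%:R :> R by rewrite ltr1n.
have sR : 0 < s%:R :> R by rewrite ltr0n.
have rs : 0 < r%:R * s%:R :> R by rewrite mulr_gt0 //; lra.
have W0 : 0 < r%:R * s%:R + 1 :> R by lra.
have u0 : 0 < s%:R / (r%:R * s%:R + 1) :> R by rewrite divr_gt0.
have u1 : s%:R / (r%:R * s%:R + 1) < r%:R^-1 :> R.
  rewrite ltr_pdivrMr // mulrDr mulrA mulVf ?mul1r ?gt_eqF //; last lra.
  by rewrite ltrDl mulr1 invr_gt0; lra.
exists ((s%:R / (r%:R * s%:R + 1) + r%:R^-1) / 2); first lra.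
move=> theta tt; apply: (@f_inf_le_block _ _ s) => //; last by move=> ?; lra.
have Cr : (1 + s%:R^-1) ^+ r.-1 * r%:R^-1 ^+ r.-1 <= C * r%:R^-1 ^+ r.-1 :> R.
  by rewrite ler_wpM2r // exprn_ge0 // invr_ge0; lra.
apply: le_trans Cr; rewrite -exprMn lerXn2r ?nnegrE //.
rewrite ler_pdivrMr // mulrDr mulr1.
have e : (1 + s%:R^-1) / r%:R * (r%:R * s%:R) = s%:R + 1 :> R.
  have -> : (1 + s%:R^-1) / r%:R * (r%:R * s%:R) =
    (r%:R^-1 * r%:R) * (s%:R + s%:R^-1 * s%:R) :> R by lra.
  by rewrite !mulVf ?gt_eqF // ?mul1r //; lra.
rewrite e lerDl mulr_ge0 // ?invr_ge0 ?addr_ge0 ?invr_ge0 //; lra.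
Qed.

Lemma f_inf_left (R : realType) (r : nat) (b C : R) :
  (1 < r)%N -> 1 < C -> 0 < b -> b <= r%:R^-1 ->
  exists2 q, 0 < q < 1 & f_inf r (q * b) <= C * f_inf r b.
Proof.
move=> r1 C1 b0 br; have r0 := ltnW r1.
have rR : 0 < r%:R :> R by rewrite ltr0n.
have [brE|bE] := eqVneq b r%:R^-1.
  have [t /andP[t0 t1] Ht] := f_inf_near_max r1 C1.
  exists (t / b); first by rewrite divr_gt0 //= ltr_pdivrMr // mul1r brE.
  rewrite divfK ?gt_eqF //; apply: le_trans (Ht _ (lexx t)) _.
  by rewrite ler_wpM2l ?f_inf_lb //; lra.
have blt : b < r%:R^-1 by rewrite lt_neqAle bE.
have rb : r%:R * b < 1 by rewrite mulrC -ltr_pdivlMr // mul1r.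
have [B B0 BC] := exists_root_le r.-1 C1.
have BR : 0 < B%:R :> R by rewrite ltr0n.
have D0 : 0 < (1 - r%:R * b) / B%:R by rewrite divr_gt0 //; lra.
exists (1 + (1 - r%:R * b) / B%:R)^-1.
  by rewrite invr_gt0 invf_lt1; lra.
rewrite mulrC; apply: le_trans (f_inf_shrink r1 B0 b0 br) _.
by rewrite ler_wpM2r // (le_trans _ (f_inf_lb r0 br)) // exprn_ge0 // invr_ge0 ltW.
Qed.

Lemma f_inf_right (R : realType) (r : nat) (b C : R) :
  (1 < r)%N -> 1 < C -> 0 < b -> b < r%:R^-1 ->
  exists2 t, b < t <= r%:R^-1 & f_inf r b <= C * f_inf r t.
Proof.
move=> r1 C1 b0 br; have r0 := ltnW r1.
have rR : 0 < r%:R :> R by rewrite ltr0n.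
have [B B0 BC] := exists_root_le r.-1 C1.
have BR : 0 < B%:R :> R by rewrite ltr0n.
pose c := (b + r%:R^-1) / 2.
have rc : r%:R * c < 1.
  by rewrite mulrC -ltr_pdivlMr // mul1r /c; lra.
have D1 : 0 < (1 - r%:R * c) / B%:R by rewrite divr_gt0 //; lra.
(* The cap at c keeps 1 - r t at least 1 - r c > 0, so shrinking at t brings t down to at most b. *)
pose t := Num.min c (b * (1 + (1 - r%:R * c) / B%:R)).
have bt : b < t by rewrite lt_min ltr_pMr // ltrDl D1 andbT /c; lra.
have tc : t <= c by rewrite ge_min lexx.
have tr : t <= r%:R^-1 by apply: le_trans tc _; rewrite /c; lra.
exists t; first by rewrite bt.
have t0 : 0 < t by lra.
apply: (@le_trans _ _ (f_inf r (t / (1 + (1 - r%:R * t) / B%:R)))).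
  apply: f_inf_antitone.
  have D2 : (1 - r%:R * c) / B%:R <= (1 - r%:R * t) / B%:R.
    by rewrite ler_wpM2r ?invr_ge0 ?(ltW BR) // lerD2l lerN2 ler_pM2l.
  rewrite ler_pdivrMr; last lra.
  apply: (@le_trans _ _ (b * (1 + (1 - r%:R * c) / B%:R))).
    by rewrite ge_min lexx orbT.
  by rewrite ler_pM2l // lerD2l.
apply: le_trans (f_inf_shrink r1 B0 t0 tr) _.
by rewrite ler_wpM2r // (le_trans _ (f_inf_lb r0 tr)) // exprn_ge0 // invr_ge0 ltW.
Qed.

Lemma f_pref_uniform_near (R : realType) (r : nat) (t C : R) :
  (0 < r)%N -> 1 < C -> t <= r%:R^-1 ->
  exists m (P : 'I_r -> rel 'I_m),
    [/\ (0 < m)%N, preference_order P & f_pref P t < C * f_inf r t].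
Proof.
move=> r0 C1 tr; apply: f_inf_approx; rewrite ltr_pMl //.
by apply: lt_le_trans (f_inf_lb r0 tr); rewrite exprn_gt0 // invr_gt0 ltr0n.
Qed.

(* One bound on m serves all theta: f varies slowly on [r^-(r-1), 1/r], and below
   r^-(r-1) the value of f_P no longer depends on theta. *)
Lemma f_pref_uniform (R : realType) (r : nat) (C : R) : (1 < r)%N -> 1 < C ->
  exists M, forall theta : R, 0 <= theta <= r%:R^-1 ->
    exists m (P : 'I_r -> rel 'I_m), [/\ (0 < m <= M)%N, preference_order P &
      f_pref P theta <= C * f_inf r theta].
Proof.
move=> r1 C1; have r0 := ltnW r1.
have rR : 0 < r%:R :> R by rewrite ltr0n.
have lb0 : 0 < r%:R^-1 ^+ r.-1 :> R by rewrite exprn_gt0 // invr_gt0.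
(* One factor C' pays for the choice of P, the other for moving theta. *)
pose C' := Num.sqrt C.
have C'1 : 1 < C' by rewrite /C' -sqrtr1 ltr_sqrt //; lra.
have C'C : C' * C' = C by rewrite -expr2 sqr_sqrtr //; lra.
(* One M serves the whole interval [t, 1/r]. This is proved near 1/r first, then extended downwards
   by a fixed ratio D. *)
pose S t := exists M, forall theta : R, t <= theta <= r%:R^-1 ->
    exists m (P : 'I_r -> rel 'I_m), [/\ (0 < m <= M)%N, preference_order P &
      f_pref P theta <= C * f_inf r theta].
have pick t theta : t <= r%:R^-1 -> t <= theta -> f_inf r t <= C' * f_inf r theta ->
    forall m (P : 'I_r -> rel 'I_m), f_pref P t < C' * f_inf r t ->
    f_pref P theta <= C * f_inf r theta.
  move=> tr tt ft m P Pt; apply: le_trans (f_pref_antitone P tt) _.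
  apply: (le_trans (ltW Pt)); rewrite -C'C -mulrA ler_wpM2l //; lra.
have [t1 /andP[t10 t1r] Ht1] := f_inf_near_max r1 C'1.
have S1 : S t1.
  have [m [P [m0 hP Pt]]] := f_pref_uniform_near r0 C'1 (ltW t1r).
  exists m => theta /andP[tt tr]; exists m, P; split => //; first by rewrite m0 /=.
  apply: pick Pt => //; first exact: ltW.
  by apply: le_trans (Ht1 _ (lexx _)) _; rewrite ler_wpM2l ?f_inf_lb //; lra.
have [b b0 bC] := exists_root_le r.-1 C'1.
have bR : 0 < b%:R :> R by rewrite ltr0n.
pose D := 1 + (1 - r%:R * t1) / b%:R.
have D1 : 1 < D.
  have : r%:R * t1 < 1 by rewrite mulrC -ltr_pdivlMr // mul1r.
  by move=> ?; rewrite ltrDl divr_gt0 //; lra.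
have Dq : 0 < D^-1 < 1 by rewrite invr_gt0 invf_lt1; lra.
(* On [t/D, t] a single order chosen at t/D is good enough: as t <= t1, shrinking at t divides it by
   at least D. *)
have step t : 0 < t -> t <= t1 -> S t -> S (D^-1 * t).
  move=> t0 tt1 [M HM].
  have tr : t <= r%:R^-1 by lra.
  have Dt : D^-1 * t <= t by rewrite ler_piMl // ltW //; lra.
  have Dtr : D^-1 * t <= r%:R^-1 by exact: le_trans tr.
  have [m [P [m0 hP Pt]]] := f_pref_uniform_near r0 C'1 Dtr.
  exists (maxn M m) => theta /andP[tt thr].
  have [lt|lt] := leP t theta.
    have tth : t <= theta <= r%:R^-1 by rewrite lt.
    have [m' [P' [/andP[m0' mM] hP' Pt']]] := HM theta tth.
    by exists m', P'; split => //; rewrite m0' leq_max mM.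
  exists m, P; split => //; first by rewrite m0 leq_maxr.
  apply: pick Pt => //.
  apply: (@le_trans _ _ (C' * f_inf r t)); last first.
    by rewrite ler_wpM2l // ?f_inf_antitone ?ltW //; lra.
  apply: (@le_trans _ _ (f_inf r (t / (1 + (1 - r%:R * t) / b%:R)))).
    apply: f_inf_antitone; rewrite mulrC ler_pM2r //.
    have Dle : D <= 1 + (1 - r%:R * t) / b%:R.
      by rewrite lerD2l ler_wpM2r ?invr_ge0 ?(ltW bR) // lerD2l lerN2 ler_pM2l.
    by rewrite lef_pV2 ?posrE //; lra.
  apply: le_trans (f_inf_shrink r1 b0 t0 tr) _.
  by rewrite ler_wpM2r // (le_trans _ (f_inf_lb r0 tr)) // ltW.
have steps j : S (D^-1 ^+ j * t1).
  elim: j => [|j IHj]; first by rewrite expr0 mul1r.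
  rewrite exprS -mulrA; apply: step IHj.
    by rewrite mulr_gt0 ?exprn_gt0 //; lra.
  by rewrite ler_piMl ?exprn_ile1 //; lra.
pose e := r%:R^-1 ^+ r.-1 : R.
have e1 : e <= r%:R^-1.
  rewrite /e; case: r r1 {r0 rR lb0 S pick t1r Ht1 S1 b b0 bC bR D D1 Dq step steps e t1 t10}
    => [|[|r]] // _.
  by rewrite /= exprS ler_piMr ?exprn_ile1 ?invr_ge0 ?invf_le1 ?ler1n ?ltr0n.
have [j je] := exists_expr_le Dq lb0.
have [M HM] := steps j.
have et : D^-1 ^+ j * t1 <= e.
  apply: le_trans je; rewrite ler_piMr ?exprn_ge0 //; first by lra.
  apply: (le_trans (ltW t1r)); rewrite invf_le1 ?ltr0n // ler1n //.
exists M => theta /andP[t0 tr].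
have [le|lt] := leP e theta.
  by apply: HM; rewrite tr andbT; apply: le_trans le.
have ete : D^-1 ^+ j * t1 <= e <= r%:R^-1 by rewrite et.
have [m [P [/andP[m0 mM] hP Pe]]] := HM e ete.
exists m, P; split => //; first by rewrite m0.
(* An index with a coordinate below e has product below e, and e is at most f_P(e); so passing from
   theta to e loses nothing. *)
apply: (le_trans (f_pref_antitone P t0)).
apply: (le_trans (f_pref0 P r1 (ltW lb0))); rewrite -/e.
have -> : Num.max (f_pref P e) e = f_pref P e.
  by apply/max_idPl; exact: f_pref_lb.
apply: le_trans Pe _; rewrite ler_wpM2l //; first by lra.
exact/f_inf_antitone/ltW.
Qed.

(** * The crossing point *)

(** The defining set has members arbitrarily close to its supremum b and none in (b, 1/r]. One-sided
    continuity of f at b then gives the two inequalities between b^alpha and f(b), each up to a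
    factor C > 1. *)
Lemma beta_spec (R : realType) (r : nat) (alpha : R) :
  (1 < r)%N -> 0 < alpha -> alpha <= r.-1%:R ->
  0 < beta r alpha <= r%:R^-1 /\
  ln (f_inf r (beta r alpha)) = alpha * ln (beta r alpha).
Proof.
move=> r1 a0 ar; have r0 := ltnW r1.
have rR : 1 < r%:R :> R by rewrite ltr1n.
have ri0 : 0 < r%:R^-1 :> R by rewrite invr_gt0; lra.
have lb0 : 0 < r%:R^-1 ^+ r.-1 :> R by rewrite exprn_gt0.
set E := [set theta : R | 0 <= theta <= r%:R^-1 /\ theta `^ alpha <= f_inf r theta]%classic.
rewrite /beta -/E; set b := sup E.
have lnri : ln r%:R^-1 < 0 :> R by rewrite ln_lt0 // ri0 invf_lt1; lra.
(* The witness r^(-(r-1)/alpha) has alpha-th power r^-(r-1), the universal lower bound of f; alpha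
   <= r - 1 puts it at or below 1/r. It makes b positive. *)
pose a := expR (r.-1%:R * ln r%:R^-1 / alpha) : R.
have Ea : E a.
  have ar' : a <= r%:R^-1.
    rewrite -[leRHS](lnK (ri0 : _ \in Num.pos)) ler_expR ler_pdivrMr // mulrC.
    by rewrite ler_wnM2l // ltW.
  split; first by rewrite expR_ge0.
  rewrite /powR gt_eqF ?expR_gt0 // expRK mulrC divfK ?gt_eqF //.
  by rewrite expRM_natl lnK ?posrE // f_inf_lb.
have Eub : has_sup E by split; [exists a | exists r%:R^-1 => t [/andP[]]].
have b0 : 0 < b by apply: lt_le_trans (expR_gt0 _) (sup_upper_bound Eub Ea).
have br : b <= r%:R^-1 by apply: ge_sup => [|t [/andP[]]//]; exists a.
split; first by rewrite b0.
have fb0 : 0 < f_inf r b by apply: lt_le_trans (f_inf_lb r0 br).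
have ba0 : 0 < b `^ alpha by rewrite powR_gt0.
have root (C : R) : 1 < C -> exists2 K, 1 < K & K `^ alpha = C.
  move=> C1; exists (expR (ln C / alpha)); first by rewrite expR_gt1 divr_gt0 ?ln_gt0.
  by rewrite -expRM divfK ?gt_eqF // lnK // posrE; lra.
have powR_le (x y : R) : 0 <= x -> x <= y -> x `^ alpha <= y `^ alpha.
  by move=> x0 xy; rewrite ge0_ler_powR ?nnegrE ?(ltW a0) //; lra.
have sq (C : R) : 1 < C -> exists2 c, 1 < c & c * c = C.
  move=> C1; exists (Num.sqrt C); first by rewrite -sqrtr1 ltr_sqrt //; lra.
  by rewrite -expr2 sqr_sqrtr //; lra.
suff <- : b `^ alpha = f_inf r b by rewrite ln_powR.
apply/eqP; rewrite eq_le; apply/andP; split.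
  (* A member t of the set lies between q' b and b. One factor c compares b^alpha with (q' b)^alpha,
     the other compares f(q b) with f(b). *)
  apply: le_of_le_mul fb0 _ => _ /sq[c c1 <-].
  have [K K1 Kc] := root _ c1; have K0 : 0 < K by lra.
  have [q /andP[q0 q1] fq] := f_inf_left r1 c1 b0 br.
  pose q' := Num.max q K^-1.
  have q'1 : q' < 1 by rewrite gt_max q1 invf_lt1.
  have q'0 : 0 < q' by rewrite lt_max q0.
  have [|t [/andP[t0 tr] tE] bt] := sup_adherent (eps := b - q' * b) _ Eub.
    by rewrite subr_gt0 gtr_pMl.
  have q'bt : q' * b <= t by apply: ltW; move: bt; rewrite -/b; lra.
  apply: (@le_trans _ _ (c * (q' * b) `^ alpha)).
    rewrite -Kc -powRM; [|lra|by rewrite mulr_ge0 // ltW].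
    apply: powR_le; first by lra.
    rewrite mulrA ler_peMl ?(ltW b0) //.
    by rewrite mulrC -ler_pdivrMr // mul1r le_max lexx orbT.
  rewrite -mulrA ler_wpM2l //; first by lra.
  apply: (le_trans _ fq); apply: (@le_trans _ _ (f_inf r (q' * b))); last first.
    by apply: f_inf_antitone; rewrite ler_pM2r // le_max lexx.
  apply: (le_trans (powR_le _ _ _ q'bt)); first by rewrite mulr_ge0 // ltW.
  by apply: (le_trans tE); exact: f_inf_antitone.
apply: le_of_le_mul ba0 _ => C C1.
(* At b = 1/r there is no room on the right, but f(1/r) is at most C r^-(r-1), and alpha <= r - 1
   compares this with b^alpha. *)
have [brE|bE] := eqVneq b r%:R^-1.
  have [t /andP[t0 t1] Ht] := f_inf_near_max r1 C1.
  apply: (@le_trans _ _ (C * r%:R^-1 ^+ r.-1)); first by apply: Ht; lra.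
  rewrite ler_wpM2l //; first by lra.
  rewrite brE -powR_mulrn ?(ltW ri0) // ger_powR // ri0 /=.
  by rewrite invf_le1 ?ltr0n // ler1n.
have blt : b < r%:R^-1 by rewrite lt_neqAle bE.
have [c c1 <-] := sq _ C1; have [K K1 Kc] := root _ c1.
have [t /andP[bt tr] ft] := f_inf_right r1 c1 b0 blt.
pose t' := Num.min t (K * b).
have bt' : b < t' by rewrite lt_min bt ltr_pMl.
have t'r : t' <= r%:R^-1 by apply: le_trans tr; rewrite ge_min lexx.
have t'E : f_inf r t' <= t' `^ alpha.
  rewrite leNgt; apply/negP => /ltW tE.
  have : t' <= b.
    apply: sup_upper_bound Eub _ _; split=> //; apply/andP; split=> //; lra.
  by rewrite leNgt bt'.
apply: (le_trans ft); rewrite -mulrA ler_wpM2l //; first by lra.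
apply: (@le_trans _ _ (f_inf r t')); first by apply: f_inf_antitone; rewrite ge_min lexx.
apply: (le_trans t'E); rewrite -Kc -powRM; [|lra|lra].
by apply: powR_le; [lra | rewrite ge_min lexx orbT].
Qed.

(** * Upper bound: colouring from a preference order *)

Lemma edge_vertex_class (r n : nat) (G : partite_hypergraph r n) (e : {set G})
    (i : 'I_r) : e \in edges G -> exists2 u, u \in e & class_of u = i.
Proof.
move=> eE; have /eqP/cards1P[u ue] := edge_transversal eE i.
have : u \in [set v in e | class_of v == i] by rewrite ue set11.
by rewrite inE => /andP[? /eqP ?]; exists u.
Qed.

Lemma edge_other_vertex (r n : nat) (G : partite_hypergraph r n) (e : {set G})
    (v : G) : (1 < r)%N -> e \in edges G -> exists2 u, u \in e & u != v.
Proof.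
move=> r1 eE; have : (0 < #|predC1 (class_of v)|)%N.
  by rewrite cardC1 card_ord -subn1 subn_gt0.
move=> /card_gt0P[j]; rewrite inE => jv; have [u ue uj] := edge_vertex_class j eE.
by exists u => //; apply: contraNneq jv => <-; rewrite uj.
Qed.

(** Remove a vertex v of low degree, colour the rest by induction, and let v avoid the colour of one
    other vertex on each of its at most K edges. [c0] supplies values outside X. *)
Lemma degenerate_colouring (R : realType) (r n : nat)
    (G : partite_hypergraph r n) (D : finType) (K : R) (X : {set G})
    (L : G -> {set D}) (c0 : G -> D) :
  (1 < r)%N -> degenerate K X -> (forall v, v \in X -> K < #|L v|%:R) ->
  exists c : G -> D, (forall v, v \in X -> c v \in L v) /\
    forall e, e \in edges G -> e \subset X -> ~ exists a, forall v, v \in e -> c v = a.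
Proof.
move=> r1; have [k] := ubnP #|X|; elim: k X => // k IHk X; rewrite ltnS => Xk dX LX.
have [->|X0] := eqVneq X finset.set0.
  exists c0; split=> [v|e eE]; first by rewrite finset.in_set0.
  rewrite finset.subset0 => /eqP e0; have [u] := edge_vertex_class (Ordinal (ltnW r1)) eE.
  by rewrite e0 finset.in_set0.
have [v vX dv] := dX X (subxx _) X0.
have XvX : X :\ v \subset X by exact: subsetDl.
have [||u /(fintype.subsetP XvX)/LX //|c [cL cE]] := IHk (X :\ v).
- by apply: leq_trans Xk; rewrite [leqRHS](cardsD1 v) vX.
- by move=> Y YX; apply: dX; apply: fintype.subset_trans XvX.
pose E := [set e in edges G | (e \subset X) && (v \in e)].
(* The default is never reached on an edge, which has at least two vertices. *)
pose u e := odflt v [pick u in e :\ v].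
pose F := [set c (u e) | e in E]%SET.
have : (#|F| < #|L v|)%N.
  rewrite -(ltr_nat R); apply: le_lt_trans (LX _ vX); apply: le_trans dv.
  by rewrite ler_nat leq_imset_card.
move=> FL; have [a aL aF] : exists2 a, a \in L v & a \notin F.
  apply/exists_inP; move: FL; apply: contraLR; rewrite negb_exists_in => /forall_inP H.
  rewrite -leqNgt subset_leq_card //; apply/fintype.subsetP => a /H.
  by rewrite negbK.
exists (fun w => if w == v then a else c w); split=> [w wX|e eE eX [b Hb]].
  by case: eqP => [->//|/eqP wv]; apply: cL; rewrite !inE wv.
have [ve|ve] := boolP (v \in e); last first.
  apply: (cE e) => //.
    apply/fintype.subsetP => w we; rewrite !inE (fintype.subsetP eX) // andbT.
    by apply: contraNneq ve => <-.
  exists b => w we; rewrite -(Hb w we); case: eqP => // wv.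
  by rewrite -wv we in ve.
have [w we wv] := edge_other_vertex v r1 eE.
have : u e \in e :\ v.
  by rewrite /u; case: pickP => [? //|/(_ w)]; rewrite !inE wv we.
rewrite !inE => /andP[uv ue].
have := Hb _ ue; rewrite (negbTE uv) => cu; have := Hb _ ve; rewrite eqxx => ab.
by move: aF; rewrite ab -cu imset_f // inE eE eX.
Qed.

(** Divided by m^|D|, the sum is the probability that at most T colours of A get a type above k.
    Markov's inequality for z^N applies: each colour of A contributes x + (1 - x) z, at most (1 + m
    z) x because x >= 1/m. For small z the loss is a small exponential in l if T is a small enough
    multiple of l. *)
Lemma sum_expr_few_above (R : realType) (D : finType) (m : nat) (le : rel 'I_m)
    (k : 'I_m) (A : {set D}) (z : R) (l T : nat) :
  total le -> 0 < z <= 1 -> (l <= #|A|)%N ->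
  \sum_(tau : {ffun D -> 'I_m}) (#|[set c in A | ~~ le (tau c) k]| <= T)%N%:R <=
    m%:R ^+ #|D| * (z ^- T * (1 + m%:R * z) ^+ l * rpos R le k ^+ l).
Proof.
move=> tot /andP[z0 z1] lA; set x := rpos R le k.
have m0 : (0 < m)%N by apply: leq_ltn_trans (ltn_ord k).
have mR : 0 < m%:R :> R by rewrite ltr0n.
pose N (tau : {ffun D -> 'I_m}) := #|[set c in A | ~~ le (tau c) k]|.
pose F (c : D) (j : 'I_m) : R := if (c \in A) && ~~ le j k then z else 1.
have NE tau : z ^+ N tau = \prod_c F c (tau c).
  rewrite /F -big_mkcond prodr_const; congr (_ ^+ _).
  by apply: eq_card => c; rewrite inE.
pose b := x + (1 - x) * z.
have /andP[x0 x1] : 0 <= x <= 1 by exact: rpos01.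
have xm : 1 <= x * m%:R.
  rewrite /x /rpos divfK ?gt_eqF // ler1n card_gt0; apply/set0Pn; exists k.
  by rewrite inE; have := tot k k; rewrite orbb.
have FE c : \sum_j F c j = m%:R * (if c \in A then b else 1).
  rewrite /F; case: (c \in A) => /=; last first.
    by rewrite sumr_const card_ord mulr1.
  have xc : #|[set j | le j k]|%:R = x * m%:R by rewrite /x /rpos divfK ?gt_eqF.
  have xc' : #|[set j | ~~ le j k]|%:R = (1 - x) * m%:R.
    have := cardsC [set j | le j k]; rewrite card_ord => /(congr1 (fun k => k%:R : R)).
    have -> : [set j | ~~ le j k] = ~: [set j | le j k].
      by apply/setP => j; rewrite !inE.
    by rewrite natrD xc; lra.
  rewrite (bigID (fun j => le j k)) /=.
  rewrite (eq_bigr (fun _ => 1)) => [|j ->//].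
  rewrite [X in _ + X](eq_bigr (fun _ => z)) => [|j ->//].
  have -> : \sum_(j | le j k) 1 = x * m%:R by rewrite -xc -sum1dep_card natr_sum.
  have -> : \sum_(j | ~~ le j k) z = (1 - x) * m%:R * z.
    by rewrite -xc' -sum1dep_card natr_sum mulr_suml; apply: eq_bigr => j _; rewrite mul1r.
  rewrite /b; lra.
have NS : \sum_tau z ^+ N tau = m%:R ^+ #|D| * b ^+ #|A|.
  under eq_bigr do rewrite NE.
  rewrite -(bigA_distr_bigA F) (eq_bigr _ (fun c _ => FE c)) big_split /=.
  by rewrite prodr_const -big_mkcond prodr_const.
have b0 : 0 <= b by rewrite /b addr_ge0 // mulr_ge0 ?(ltW z0) // subr_ge0.
have b1 : b <= 1.
  have : (1 - x) * z <= (1 - x) * 1 by rewrite ler_wpM2l // subr_ge0.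
  rewrite /b; lra.
have bx : b <= (1 + m%:R * z) * x.
  have : z <= x * m%:R * z by rewrite ler_peMl // ltW.
  have : 0 <= x * z by rewrite mulr_ge0 // ltW.
  rewrite /b; lra.
apply: (@le_trans _ _ (\sum_tau z ^- T * z ^+ N tau)).
  apply: ler_sum => tau _; rewrite -/(N tau); case: leqP => NT /=.
    rewrite mulrC ler_pdivlMr ?exprn_gt0 // mul1r.
    by rewrite ler_wiXn2l // ltW.
  by rewrite mulr_ge0 ?invr_ge0 ?exprn_ge0 // ltW.
rewrite -mulr_sumr NS mulrCA ler_wpM2l ?exprn_ge0 ?ler0n // -mulrA.
rewrite ler_wpM2l ?invr_ge0 ?exprn_ge0 ?(ltW z0) // -exprMn.
apply: (@le_trans _ _ (b ^+ l)); first exact: ler_wiXn2l.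
by rewrite lerXn2r ?nnegrE // (le_trans b0).
Qed.

Lemma exists_le_average (R : realType) (T : finType) (F : T -> R) (c : R) :
  (0 < #|T|)%N -> \sum_t F t <= #|T|%:R * c -> exists t, F t <= c.
Proof.
move=> /card_gt0P[t0 _] H; have [/existsP//|] := boolP [exists t, F t <= c].
rewrite negb_exists => /forallP F1; move: H; rewrite leNgt => /negP[].
rewrite mulr_natl -sumr_const; apply: ltr_sum; last by move=> t _; rewrite ltNge F1.
by apply/hasP; exists t0; rewrite // mem_index_enum.
Qed.

Lemma card_vertex (r n : nat) (G : partite_hypergraph r n) : #|G| = (r * n)%N.
Proof.
rewrite -sum1_card (partition_big (@class_of r n G) predT) //=.
rewrite (eq_bigr (fun _ => n)) => [|i _]; first by rewrite sum_nat_const card_ord.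
by rewrite sum1dep_card card_class.
Qed.

Lemma card_le_fibers (D : finType) (m t : nat) (tau : D -> 'I_m) (A B : {set D}) :
  A \subset B ->
  (forall c, c \in A -> #|[set c' in B | tau c' == tau c]| <= t)%N ->
  (#|A| <= m * t)%N.
Proof.
move=> AB H; rewrite -sum1_card (partition_big tau predT) //=.
rewrite -[m in leqRHS]card_ord -sum_nat_const; apply: leq_sum => j _.
rewrite sum1dep_card.
have [->|[c]] := set_0Vmem [set x in A | tau x == j]; first by rewrite cards0.
rewrite inE => /andP[cA /eqP <-]; apply: leq_trans (H c cA).
by rewrite subset_leq_card //; apply/fintype.subsetP => x; rewrite !inE =>
  /andP[/(fintype.subsetP AB) -> ->].
Qed.

(** Restricting to the finite union of the lists allows random types to be drawn for all colours. *)
Lemma list_colourable_finType (r n l : nat) (G : partite_hypergraph r n) :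
  (0 < r)%N ->
  (forall (D : finType) (L : G -> {set D}), (forall v, l <= #|L v|)%N ->
    exists c : G -> D, (forall v, c v \in L v) /\
      forall e, e \in edges G -> ~ exists a, forall v, v \in e -> c v = a) ->
  choosable G l.
Proof.
move=> r0 H C L Ll; pose S := (\bigcup_(v <- enum G) L v)%fset.
have LS v x : x \in L v -> x \in S.
  by move=> xL; apply/bigfcupP; exists v; rewrite ?mem_enum.
pose L' v := [set x : S | val x \in L v].
have [|c [cL cE]] := H _ L'.
  move=> v; apply: leq_trans (Ll v) _.
  rewrite cardE -(size_map val); apply: uniq_leq_size; first exact: fset_uniq.
  move=> x xL; apply/mapP; exists [` LS v x xL]%fset => //.
  by rewrite mem_enum inE.
exists (fun v => val (c v)); split=> [v|e eE [a Ha]].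
  by have := cL v; rewrite inE.
have [v ve _] := edge_vertex_class (Ordinal r0) eE.
by apply: (cE e eE); exists (c v) => u ue; apply: val_inj; rewrite /= !Ha.
Qed.

(** B collects the loss of the Markov bound and the factor r m paid for treating all classes and
    types at once. For vertices using type k, the condition on B n theta^l empties class i when x_i
    < theta, and the condition on f_P otherwise brings their product within reach of property D. *)
Lemma choosable_of_preference (R : realType) (r n : nat)
    (G : partite_hypergraph r n) (d z theta : R) (m l t : nat)
    (P : 'I_r -> rel 'I_m) :
  let B := r%:R * m%:R * (z ^- (m * t) * (1 + m%:R * z) ^+ l) in
  (1 < r)%N -> (0 < n)%N -> 0 < d -> property_D G d ->
  (0 < m)%N -> preference_order P -> 0 < z <= 1 -> (m * t < l)%N ->
  4 * ln d / ln (ln d) < t%:R -> 0 <= theta ->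
  B * n%:R * theta ^+ l < 1 -> B ^+ r.-1 * f_pref P theta ^+ l < d^-1 ->
  choosable G l.
Proof.
move=> B r1 n0 d0 hD m0 hP z01 mtl dt th0 Bth Bf; have r0 := ltnW r1.
apply: list_colourable_finType => // D L Ll.
have nR : 0 < n%:R :> R by rewrite ltr0n.
have mR : 0 < m%:R :> R by rewrite ltr0n.
have rR : 0 < r%:R :> R by rewrite ltr0n.
have /andP[z0 z1] := z01.
pose Q : R := z ^- (m * t) * (1 + m%:R * z) ^+ l.
have Q0 : 0 < Q.
  by rewrite /Q mulr_gt0 ?invr_gt0 ?exprn_gt0 // addr_gt0 // mulr_gt0.
have x0 i k : 0 < rpos R (P i) k.
  rewrite /rpos divr_gt0 // ltr0n card_gt0; apply/set0Pn; exists k.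
  by have [_ _ to] := hP i; rewrite inE; have := to k k; rewrite orbb.
(* If v uses type k, each type above k occurs fewer than t times in its list. This consequence has a
   tractable probability. *)
pose bad (tau : {ffun D -> 'I_m}) (v : G) k :=
  (#|[set c in L v | ~~ P (class_of v) (tau c) k]| <= m * t)%N.
pose q (v : G) k := n%:R * (Q * rpos R (P (class_of v)) k ^+ l).
have q0 v k : 0 < q v k by rewrite /q (mulr_gt0 nR) // (mulr_gt0 Q0) // exprn_gt0.
(* Each of the r n m terms has mean at most 1/n, so some [tau] gives F <= r m. This bounds the
   counts for every class and type simultaneously. *)
pose F (tau : {ffun D -> 'I_m}) := \sum_v \sum_k (bad tau v k)%:R / q v k.
have [tau Ftau] : exists tau, F tau <= r%:R * m%:R.
  apply: exists_le_average; first by rewrite card_ffun card_ord expn_gt0 m0.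
  rewrite card_ffun card_ord natrX exchange_big /=.
  apply: (@le_trans _ _ (\sum_(v : G) \sum_(k < m) m%:R ^+ #|D| / n%:R)).
    apply: ler_sum => v _; rewrite exchange_big /=; apply: ler_sum => k _.
    rewrite -mulr_suml ler_pdivrMr //.
    have [_ _ to] := hP (class_of v).
    apply: le_trans (sum_expr_few_above k (m * t)%N to z01 (Ll v)) _.
    by rewrite /q [leRHS]mulrA divfK ?gt_eqF.
  rewrite !sumr_const card_ord card_vertex -[leLHS]mulr_natl -[X in _ * X]mulr_natl natrM.
  have -> : r%:R * n%:R * (m%:R * (m%:R ^+ #|D| / n%:R)) =
    m%:R ^+ #|D| * (r%:R * m%:R) * (n%:R / n%:R) :> R by lra.
  by rewrite mulfV ?gt_eqF // mulr1.
have few i k : #|[set v | (class_of v == i) && bad tau v k]|%:R <=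
    B * n%:R * rpos R (P i) k ^+ l.
  pose qi := n%:R * (Q * rpos R (P i) k ^+ l).
  have qi0 : 0 < qi by rewrite /qi (mulr_gt0 nR) // (mulr_gt0 Q0) // exprn_gt0.
  have -> : B * n%:R * rpos R (P i) k ^+ l = r%:R * m%:R * qi by rewrite /B /qi -/Q; lra.
  rewrite -ler_pdivrMr //; apply: le_trans Ftau.
  rewrite -sum1_card natr_sum mulr_suml big_mkcond /=; apply: ler_sum => v _.
  rewrite inE; case: andP => [[/eqP vi vk]|_].
    rewrite (bigD1 k) //= vk.
    have -> : q v k = qi by rewrite /q vi.
    by rewrite mul1r lerDl sumr_ge0 // => k' _; rewrite divr_ge0 ?ler0n // ltW.
  by rewrite sumr_ge0 // => k' _; rewrite divr_ge0 // ltW.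
have /choice[h hh] v : exists h, (t <= #|[set c in L v | tau c == h]|)%N /\
    forall j, (t <= #|[set c in L v | tau c == j]|)%N -> P (class_of v) j h.
  pose O := [pred j | (t <= #|[set c in L v | tau c == j]|)%N].
  have [j0 j0O] : exists j0, j0 \in O.
    apply/existsP; apply: contraLR (leq_trans mtl (Ll v)).
    rewrite negb_exists -leqNgt => /forallP H.
    apply: (card_le_fibers (tau := tau) (subxx _)) => c _.
    by have := H (tau c); rewrite inE -ltnNge => /ltnW.
  by have [j jO jmax] := linear_order_max (hP (class_of v)) j0O; exists j.
have badh v k : h v = k -> bad tau v k.
  move=> <-; have [_ hmax] := hh v; apply: (card_le_fibers (tau := tau) (B := L v)).
    by apply/fintype.subsetP => c; rewrite inE => /andP[].
  move=> c; rewrite inE => /andP[cL nP]; rewrite leqNgt; apply/negP => /ltnW /hmax.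
  exact/negP.
pose X k := [set v | h v == k].
have dX k : degenerate (4 * ln d / ln (ln d)) (X k).
  apply: hD.
  have Xi i : #|class_part (X k) i|%:R <= B * n%:R * rpos R (P i) k ^+ l.
    apply: le_trans (few i k); rewrite ler_nat subset_leq_card //.
    by apply/fintype.subsetP => v; rewrite !inE => /andP[/eqP/badh -> ->].
  have B00 : 0 <= B by apply: mulr_ge0 (ltW Q0); rewrite mulr_ge0 // ltW.
  have B0 : 0 <= B * n%:R by rewrite mulr_ge0 // ltW.
  have [/forallP H|] := boolP [forall i, theta <= rpos R (P i) k].
    apply: (@le_lt_trans _ _ (prod_but_max (fun i => B * n%:R * rpos R (P i) k ^+ l))).
      by apply: le_prod_but_max => i; rewrite ler0n Xi.
    rewrite prod_but_max_scaleX // => [|i]; last exact: ltW.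
    rewrite exprMn mulrAC mulrC ltr_pM2l ?exprn_gt0 //; apply: le_lt_trans Bf.
    rewrite ler_wpM2l ?exprn_ge0 //.
    apply: lerXn2r; rewrite ?nnegrE ?f_pref_ge0 //; last exact: f_pref_ge.
    by apply: prod_but_max_ge0 => i; exact: ltW.
  rewrite negb_forall => /existsP[i]; rewrite -ltNge => lti.
  have Xi0 : #|class_part (X k) i| = 0%N.
    have : #|class_part (X k) i|%:R < 1 :> R.
      apply: le_lt_trans (Xi i) _; apply: le_lt_trans Bth.
      by rewrite ler_wpM2l // lerXn2r ?nnegrE ?(ltW (x0 _ _)) // ltW.
    by rewrite -[1]/(1%:R) ltr_nat ltnS leqn0 => /eqP.
  have -> : Defs.size_prod R (X k) = 0.
    by apply: (prod_but_max_eq0 r1 (j := i)) => [j|]; rewrite ?ler0n // Xi0.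
  by rewrite divr_gt0 // exprn_gt0.
have [a0 _] : exists a0 : D, true.
  have [v _] : exists v : G, true.
    have : (0 < #|G|)%N by rewrite card_vertex muln_gt0 r0.
    by move=> /card_gt0P[v _]; exists v.
  have : (0 < #|L v|)%N by apply: leq_trans (Ll v); apply: leq_ltn_trans mtl.
  by move=> /card_gt0P[a _]; exists a.
pose Lk k v := [set c in L v | tau c == k].
have /choice[c cc] k : exists c : G -> D, (forall v, v \in X k -> c v \in Lk k v) /\
    forall e, e \in edges G -> e \subset X k -> ~ exists a, forall v, v \in e -> c v = a.
  apply: (degenerate_colouring (fun _ => a0) r1 (dX k)) => v.
  rewrite inE => /eqP <-; apply: (lt_le_trans dt); rewrite ler_nat.
  by have [] := hh v.
have ccL v : c (h v) v \in Lk (h v) v by have [H _] := cc (h v); apply: H; rewrite inE.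
(* Different types have disjoint palettes, so an edge coloured a lies inside X (tau a). *)
exists (fun v => c (h v) v); split=> [v|e eE [a Ha]].
  by have := ccL v; rewrite inE => /andP[].
have he v : v \in e -> h v = tau a.
  by move=> ve; have := ccL v; rewrite inE (Ha v ve) => /andP[_ /eqP].
have [_ ccE] := cc (tau a); apply: (ccE e eE).
  by apply/fintype.subsetP => v ve; rewrite inE he.
by exists a => v ve; rewrite -(he v ve) Ha.
Qed.

(** * Lower bound: spread lists *)

Lemma ffact_ge (s k l : nat) : (l <= k)%N -> ((s - k) ^ l <= s ^_ l)%N.
Proof.
elim: l => [|l IHl] lk; first by rewrite expn0 ffactn0.
by rewrite expnSr ffactnSr leq_mul ?IHl ?leq_sub2l // ltnW.
Qed.

Lemma ffact_le (s l : nat) : (s ^_ l <= s ^ l)%N.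
Proof.
elim: l => [|l IHl]; first by rewrite expn0 ffactn0.
by rewrite expnSr ffactnSr leq_mul ?leq_subr.
Qed.

(** The ratio is the probability that a random l-subset of M points lies in a given s-subset. It is
    at least ((s - l)/M)^l, and Bernoulli's inequality with 2 l^2 <= s loses at most one half. *)
Lemma bin_ratio_ge (R : realType) (s M l : nat) :
  (0 < s)%N -> (2 * (l * l) <= s)%N -> (s <= M)%N ->
  (s%:R / M%:R) ^+ l / 2 <= 'C(s, l)%:R / 'C(M, l)%:R :> R.
Proof.
move=> s0 ls sM; have M0 := leq_trans s0 sM.
have sR : 0 < s%:R :> R by rewrite ltr0n.
have lls : (l <= s)%N.
  by apply: leq_trans ls; case: l => // l; rewrite mulnA leq_pmull.
have lM := leq_trans lls sM.
have f0 : 0 < l`!%:R :> R by rewrite ltr0n fact_gt0.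
have -> : 'C(s, l)%:R / 'C(M, l)%:R = (s ^_ l)%:R / (M ^_ l)%:R :> R.
  by rewrite -!bin_ffact !natrM invfM mulrACA mulfV ?mulr1 // gt_eqF.
have ML : 0 < (M ^_ l)%:R :> R by rewrite ltr0n ffact_gt0.
have MR : 0 < M%:R :> R by rewrite ltr0n.
apply: (@le_trans _ _ ((s%:R - l%:R) ^+ l / M%:R ^+ l)); last first.
  apply: ler_pM; rewrite ?exprn_ge0 ?invr_ge0 ?exprn_ge0 ?subr_ge0 ?ler_nat ?ler0n //.
    by rewrite -natrB // -natrX ler_nat ffact_ge.
  by rewrite lef_pV2 ?posrE ?exprn_gt0 // -natrX ler_nat ffact_le.
rewrite expr_div_n mulrAC ler_wpM2r ?invr_ge0 ?exprn_ge0 ?ler0n //.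
have -> : s%:R - l%:R = s%:R * (1 + - (l%:R / s%:R)) :> R.
  by rewrite mulrDr mulr1 mulrN mulrCA mulfV ?mulr1 // gt_eqF.
rewrite exprMn ler_wpM2l ?exprn_ge0 ?ler0n //.
apply: le_trans (bernoulli _ _); last first.
  by rewrite lerN2 ler_pdivrMr // mul1r ler_nat.
have : l%:R * (l%:R / s%:R) <= 2^-1 :> R; last lra.
rewrite mulrA ler_pdivrMr // -natrM.
have : (2 * (l * l))%:R <= s%:R :> R by rewrite ler_nat.
by rewrite natrM; lra.
Qed.

(** For independent uniform l-subsets the count N of a pair (i, S) satisfies E exp(-N) <= exp(-n p /
    2). Weighting by exp(n p / 4) and summing over at most r 2^M pairs leaves a mean below 1, so one
    outcome has N >= n p / 4 for all pairs. *)
Lemma exists_spread_lists (R : realType) (r n : nat)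
    (G : partite_hypergraph r n) (M l : nat) (theta : R) :
  0 < theta <= 1 -> (0 < M)%N -> (2 * (l * l))%:R <= theta * M%:R ->
  r%:R * 2 ^+ M * expR (- (n%:R * theta ^+ l / 8)) < 1 ->
  exists L : G -> {set 'I_M}, (forall v, #|L v| = l) /\
    forall i (S : {set 'I_M}), theta * M%:R <= #|S|%:R :> R ->
    n%:R * (#|S|%:R / M%:R) ^+ l / 8 <=
      #|[set v | (class_of v == i) && (L v \subset S)]|%:R :> R.
Proof.
move=> /andP[t0 t1] M0 lM small.
have MR : 0 < M%:R :> R by rewrite ltr0n.
pose K : finType := {A : {set 'I_M} | #|A| == l}.
have cK (S : {set 'I_M}) : #|[set A : K | val A \subset S]| = 'C(#|S|, l).
  rewrite -cards_draws -(card_imset _ val_inj); apply: eq_card => A.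
  rewrite inE; apply/imsetP/andP => [[B]|[AS Al]].
    by rewrite inE => BS ->; rewrite BS (valP B).
  by exists (Sub A Al : K); rewrite ?inE ?SubK.
have cK' : #|K| = 'C(M, l).
  have := cK [set: 'I_M]; rewrite cardsT card_ord => <-.
  by rewrite -cardsT; apply: eq_card => A; rewrite !inE finset.subsetT.
have lM' : (l <= M)%N.
  have : (2 * (l * l) <= M)%N.
    by rewrite -(ler_nat R); apply: le_trans lM _; rewrite ler_piMl // ltW.
  by apply: leq_trans; case: (l) => // k; rewrite mulnA leq_pmull.
have K0 : 0 < #|K|%:R :> R by rewrite cK' ltr0n bin_gt0.
pose p (S : {set 'I_M}) : R := 'C(#|S|, l)%:R / #|K|%:R.
have pge (S : {set 'I_M}) : theta * M%:R <= #|S|%:R -> (#|S|%:R / M%:R) ^+ l / 2 <= p S.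
  move=> tS; rewrite /p cK'; apply: bin_ratio_ge.
  - by rewrite -(ltr_nat R); apply: lt_le_trans tS; rewrite mulr_gt0.
  - by rewrite -(ler_nat R); apply: le_trans tS.
  - by rewrite -[leqRHS]card_ord max_card.
pose N (h : {ffun G -> K}) i (S : {set 'I_M}) := #|[set v | (class_of v == i) && (val (h v) \subset S)]|.
have sumN i S : \sum_h expR (- (N h i S)%:R) <= #|{ffun G -> K}|%:R * expR (- (n%:R * p S / 2)).
  pose f (v : G) (A : K) : R := if (class_of v == i) && (val A \subset S) then expR (-1) else 1.
  have NE h : expR (- (N h i S)%:R) = \prod_v f v (h v).
    rewrite /f -big_mkcond prodr_const -expRM_natl mulrN1; congr (expR (- _%:R)).
    by apply: eq_card => v; rewrite inE.
  under eq_bigr do rewrite NE.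
  rewrite -(bigA_distr_bigA f).
  (* A vertex of class i contributes 1 - (1 - 1/e) p <= 1 - p/2 <= exp(-p/2). *)
  have e2 : expR (-1) <= 2^-1 :> R.
    by rewrite expRN lef_pV2 ?posrE ?expR_gt0 //; have := expR_ge1Dx (1 : R); lra.
  have fE v : 0 <= \sum_A f v A <= #|K|%:R * (if class_of v == i then expR (- (p S / 2)) else 1).
    apply/andP; split.
      by apply: sumr_ge0 => A _; rewrite /f; case: ifP => // _; exact: expR_ge0.
    rewrite /f; case: (class_of v == i) => /=; last first.
      by rewrite sumr_const mulr1.
    apply: (@le_trans _ _ (#|K|%:R - 'C(#|S|, l)%:R / 2)); last first.
      have -> : 'C(#|S|, l)%:R = #|K|%:R * p S.
        by rewrite /p mulrCA mulfV ?mulr1 // gt_eqF.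
      rewrite -mulrA -[X in X - _]mulr1 -mulrBr ler_wpM2l ?ler0n //.
      exact: expR_ge1Dx.
    have -> : \sum_(A : K) (if val A \subset S then expR (-1) else 1) =
        \sum_(A : K) (1 - (1 - expR (-1)) * (val A \subset S)%:R) :> R.
      by apply: eq_bigr => A _; case: (val A \subset S); rewrite ?mulr1 ?mulr0; lra.
    rewrite sumrB sumr_const -mulr_sumr.
    have -> : \sum_(A : K) (val A \subset S)%:R = 'C(#|S|, l)%:R :> R.
      rewrite -cK -sum1_card natr_sum [RHS]big_mkcond; apply: eq_bigr => A _.
      by rewrite inE; case: ifP.
    have : 0 <= 'C(#|S|, l)%:R :> R by rewrite ler0n.
    by move: ('C(_, _)%:R) => y y0; nra.
  apply: (@le_trans _ _ (\prod_v (#|K|%:R * (if class_of v == i then expR (- (p S / 2)) else 1)))).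
    exact: ler_prod.
  rewrite big_split /= prodr_const -big_mkcond prodr_const /= card_ffun natrX.
  have -> : #|(fun v : G => class_of v == i)| = n.
    by rewrite -[RHS](card_class G i) cardsE.
  by rewrite -expRM_natl mulrN mulrA.
pose c := r%:R * 2 ^+ M * expR (- (n%:R * theta ^+ l / 8)).
have [h Fh] : exists h : {ffun G -> K},
    \sum_i \sum_(S : {set 'I_M} | theta * M%:R <= #|S|%:R)
      expR (n%:R * p S / 4) * expR (- (N h i S)%:R) <= c.
  apply: exists_le_average.
    by rewrite card_ffun expn_gt0 -(ltr0n R) K0.
  rewrite exchange_big /=.
  apply: (@le_trans _ _ (\sum_(i < r) \sum_(S : {set 'I_M})
     #|{ffun G -> K}|%:R * expR (- (n%:R * theta ^+ l / 8)))).
    apply: ler_sum => i _; rewrite exchange_big /= big_mkcond /=; apply: ler_sum => S _.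
    case: ifP => [tS|_]; last by rewrite mulr_ge0 ?expR_ge0.
    rewrite -mulr_sumr; apply: le_trans (ler_wpM2l (expR_ge0 _) (sumN i S)) _.
    rewrite mulrCA ler_wpM2l ?ler0n // -expRD ler_expR.
    have : n%:R * (theta ^+ l / 2) <= n%:R * p S.
      rewrite ler_wpM2l ?ler0n //; apply: le_trans (pge _ tS).
      rewrite ler_wpM2r // lerXn2r ?nnegrE ?divr_ge0 // ?ler_pdivlMr //.
      exact: ltW.
    lra.
  have cM : #|{set 'I_M}|%:R = 2 ^+ M :> R.
    by rewrite -cardsT -powersetT card_powerset cardsT card_ord natrX.
  by rewrite !sumr_const card_ord -[leLHS]mulr_natr -[X in X * _]mulr_natr cM /c; lra.
have Fh1 := le_lt_trans Fh small.
exists (fun v => val (h v)); split=> [v|i S tS]; first exact/eqP/(valP (h v)).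
(* A failing pair alone would contribute at least 1. *)
rewrite leNgt; apply/negP => Nlt; move: Fh1; rewrite ltNge => /negP[].
rewrite (bigD1 i) //= (bigD1 S) //= -addrA -expRD ler_wpDr //.
  by rewrite addr_ge0 // !sumr_ge0 // => *; rewrite ?sumr_ge0 // => *; rewrite mulr_ge0 ?expR_ge0.
rewrite -[leLHS]expR0 ler_expR.
have : n%:R * ((#|S|%:R / M%:R) ^+ l / 2) <= n%:R * p S.
  by rewrite ler_wpM2l ?ler0n // pge.
by rewrite /N; lra.
Qed.

Lemma not_choosable (R : realType) (r n : nat) (G : partite_hypergraph r n)
    (d theta phi : R) (M l : nat) :
  (1 < r)%N -> property_I G d -> 0 < theta <= 1 -> (0 < M)%N ->
  (2 * (l * l))%:R <= theta * M%:R ->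
  r%:R * 2 ^+ M * expR (- (n%:R * theta ^+ l / 8)) < 1 ->
  0 < phi -> phi <= f_inf r theta ->
  n%:R ^+ r.-1 / d * ln d ^+ 2 <= (n%:R / 8 / M%:R) ^+ r.-1 * phi ^+ l ->
  ~ choosable G l.
Proof.
move=> r1 hI t01 M0 lM small phi0 phif big ch; have r0 := ltnW r1.
have MR : 0 < M%:R :> R by rewrite ltr0n.
have [L [Ll Lspread]] := exists_spread_lists G t01 M0 lM small.
pose L' v := seq_fset tt (enum (L v)).
have L'l v : (l <= #|` L' v|)%N.
  by rewrite size_seq_fset undup_id ?enum_uniq // -cardE Ll.
have [c [cL cE]] := ch _ L' L'l.
have {}cL v : c v \in L v by have := cL v; rewrite seq_fsetE mem_enum.
pose X k := [set v | c v == k].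
have Xind k : independent (X k).
  move=> e eE; apply/negP => /fintype.subsetP eX; apply: (cE e eE); exists k => v /eX.
  by rewrite inE => /eqP.
pose a i k := #|class_part (X k) i|.
pose P i (j k : 'I_M) := if a i j == a i k then (j <= k)%N else (a i j <= a i k)%N.
have hP : preference_order P.
  move=> i; apply: (linear_order_lex (le := leq)) => [|j k _ jk kj|j k h|j k].
  - exact: (linear_order_key (@inj_id nat)).
  - by apply/val_inj/eqP; rewrite eqn_leq jk.
  - exact: leq_trans.
  - exact: leq_total.
have : phi <= f_pref P theta := le_trans phif (f_inf_le_pref theta M0 hP).
(* phi > 0 rules out the default 0 of the maximum, so some colour k attains it. *)
move=> /bigmax_geP[|[k /forallP kt kphi]]; first by rewrite leNgt phi0.
(* The lists inside S, the colours at or below k, belong to at least n x^l / 8 vertices of class i.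
   These share at most M colours of S, none more frequent in class i than k. *)
have ak i : n%:R / 8 / M%:R * rpos R (P i) k ^+ l <= (a i k)%:R.
  pose S := [set j | P i j k].
  have tS : theta * M%:R <= #|S|%:R by rewrite -ler_pdivlMr // -/(rpos R (P i) k).
  have -> : n%:R / 8 / M%:R * rpos R (P i) k ^+ l =
    (n%:R * (#|S|%:R / M%:R) ^+ l / 8) / M%:R by rewrite /rpos -/S; lra.
  rewrite ler_pdivrMr //; apply: le_trans (Lspread i S tS) _.
  rewrite -natrM ler_nat; apply: (@leq_trans (\sum_(j in S) a i j)%N).
    rewrite -sum1_card (partition_big c (mem S)) /=; last first.
      by move=> v; rewrite inE => /andP[_ /fintype.subsetP]; apply; exact: cL.
    apply: leq_sum => j _; rewrite sum1dep_card subset_leq_card //.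
    by apply/fintype.subsetP => v; rewrite !inE => /andP[/andP[-> _] ->].
  apply: (@leq_trans (\sum_(j in S) a i k)%N).
    by apply: leq_sum => j; rewrite inE /P; case: eqP => [->|].
  by rewrite sum_nat_const mulnC leq_mul // -[leqRHS]card_ord max_card.
have := hI _ (Xind k); rewrite ltNge => /negP[]; apply: (le_trans big).
apply: (@le_trans _ _ (prod_but_max (fun i => n%:R / 8 / M%:R * rpos R (P i) k ^+ l))).
  rewrite prod_but_max_scaleX // => [|i]; last exact: rpos_ge0.
  rewrite ler_wpM2l ?exprn_ge0 // lerXn2r ?nnegrE ?(ltW phi0) //.
  exact: le_trans (ltW phi0) kphi.
apply: le_prod_but_max => i; rewrite ak andbT mulr_ge0 ?exprn_ge0 //.
exact: rpos_ge0.
Qed.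

(** * Asymptotics *)

(** Indices excluded at r^-(r-1) have products below the value guaranteed there. The lower bound can
    thus raise its threshold to a positive constant depending on r, which keeps the palette
    small. *)
Lemma f_inf_flat (R : realType) (r : nat) (theta : R) : (1 < r)%N ->
  0 <= theta -> f_inf r theta <= f_inf r (r%:R^-1 ^+ r.-1 : R).
Proof.
move=> r1 t0; have r0 := ltnW r1.
have rR : 0 < r%:R :> R by rewrite ltr0n.
have e0 : 0 <= r%:R^-1 ^+ r.-1 :> R by rewrite exprn_ge0 // invr_ge0 ltW.
have e1 : r%:R^-1 ^+ r.-1 <= r%:R^-1 :> R.
  case: r r1 {r0 rR e0} => [|[|r]] // _.
  by rewrite /= exprS ler_piMr ?exprn_ile1 ?invr_ge0 ?invf_le1 ?ler1n ?ltr0n.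
apply: f_inf_ge => m P m0 hP; apply: le_trans (f_inf_le_pref theta m0 hP) _.
apply: le_trans (f_pref_antitone P t0) _; apply: le_trans (f_pref0 P r1 e0) _.
by rewrite ge_max lexx /=; exact: f_pref_lb.
Qed.

(** The Taylor term of degree p + 1 suffices. *)
Lemma expR_dominates (R : realType) (kappa A : R) (p : nat) : 0 < kappa -> 0 <= A ->
  exists2 l0 : R, 1 <= l0 & forall l, l0 <= l -> A * l ^+ p < expR (kappa * l).
Proof.
move=> k0 A0.
have f0 : 0 < p.+1`!%:R :> R by rewrite ltr0n fact_gt0.
have k1 : 0 < kappa ^+ p.+1 by rewrite exprn_gt0.
have h0 : 0 <= A * p.+1`!%:R / kappa ^+ p.+1.
  by rewrite divr_ge0 ?mulr_ge0 ?(ltW f0) ?(ltW k1).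
exists (1 + A * p.+1`!%:R / kappa ^+ p.+1); first by rewrite lerDl.
move=> l hl; have l1 : 1 <= l by apply: le_trans hl; rewrite lerDl.
have l0 : 0 < l by lra.
have kl : 0 <= kappa * l by rewrite mulr_ge0 ?ltW.
have := expR_ge1Dxn p kl; set Y := _ / _ => hY.
suff : A * l ^+ p <= Y by lra.
rewrite /Y ler_pdivlMr // exprMn [l ^+ p.+1]exprS.
have -> : kappa ^+ p.+1 * (l * l ^+ p) = (kappa ^+ p.+1 * l) * l ^+ p by rewrite mulrA.
rewrite mulrAC ler_wpM2r ?exprn_ge0 ?(ltW l0) //.
by rewrite mulrC [leRHS]mulrC mulrC -ler_pdivrMr //; lra.
Qed.

Lemma log_ratio_facts (R : realType) (r n : nat) (d : R) : 1 < d ->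
  d <= n%:R ^+ r.-1 ->
  [/\ (0 < n)%N, 0 < log_base n%:R d, log_base n%:R d <= r.-1%:R &
      n%:R = expR (ln d / log_base n%:R d)].
Proof.
move=> d1 dn; have ld := ln_gt0 d1.
have n1 : (1 < n)%N.
  rewrite ltnNge; apply/negP => n1; move: dn; apply/negP; rewrite -ltNge.
  by apply: le_lt_trans d1; rewrite exprn_ile1 // lern1.
have nR : 1 < n%:R :> R by rewrite ltr1n.
have ln_n := ln_gt0 nR.
split; first exact: ltnW.
- by rewrite divr_gt0.
- rewrite /log_base ler_pdivrMr //.
  have n0 : 0 < n%:R :> R by lra.
  rewrite mulr_natl -lnXn // ler_ln ?posrE ?exprn_gt0 //; lra.
- rewrite /log_base invf_div mulrCA mulfV ?gt_eqF // mulr1 lnK // posrE; lra.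
Qed.

Lemma neg_ln_f_inf_bounds (R : realType) (r : nat) (theta : R) :
  (1 < r)%N -> theta <= r%:R^-1 ->
  ln (3 / 2) <= - ln (f_inf r theta) <= r.-1%:R * ln r%:R.
Proof.
move=> r1 tr; have r0 := ltnW r1.
have rR : 0 < r%:R :> R by rewrite ltr0n.
have lb := f_inf_lb r0 tr; have ub := f_inf_ub theta r1.
have lb0 : 0 < r%:R^-1 ^+ r.-1 :> R by rewrite exprn_gt0 // invr_gt0.
have f0 := lt_le_trans lb0 lb.
have i0 : 0 < r%:R^-1 :> R by rewrite invr_gt0.
apply/andP; split.
  by rewrite lerNr -lnV ?posrE // ler_ln ?posrE ?invf_div.
rewrite lerNl mulr_natl -mulNrn -lnV ?posrE // -lnXn // ler_ln ?posrE //.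
Qed.

Lemma g_prefE (R : realType) (r : nat) (alpha : R) : 0 < alpha ->
  g_pref r alpha = ln r%:R / - ln (f_inf r (beta r alpha)).
Proof. by move=> a0; rewrite /g_pref gt_eqF // /g_pos /log_base invf_div invrN mulrN. Qed.

(** Here l stands for ln d. Half of delta absorbs the quotient once ln l >= 8/delta, the other half
    the rounding up once l >= 2/delta. *)
Lemma threshold_small (R : realType) (delta : R) : 0 < delta ->
  exists2 l0 : R, 1 < l0 & forall l, l0 <= l ->
    exists t : nat, 4 * l / ln l < t%:R /\ t%:R <= delta * l.
Proof.
move=> d0; exists (Num.max (expR (8 / delta)) (2 + 2 / delta)).
  have d2 : 0 < 2 / delta by rewrite divr_gt0.
  by rewrite lt_max; apply/orP; right; lra.
move=> l; rewrite ge_max => /andP[le1 le2].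
have dd : 0 < 8 / delta by rewrite divr_gt0.
have d2 : 0 < 2 / delta by rewrite divr_gt0.
have l0 : 0 < l by lra.
have lnl : 8 / delta <= ln l.
  by rewrite -[leLHS]expRK ler_ln ?posrE ?expR_gt0.
have lnl0 : 0 < ln l by lra.
have q0 : 0 <= 4 * l / ln l by rewrite divr_ge0 ?mulr_ge0 ?ltW.
have ql : 4 * l / ln l <= delta / 2 * l.
  rewrite ler_pdivrMr //.
  have : delta / 2 * l * (8 / delta) <= delta / 2 * l * ln l.
    by rewrite ler_wpM2l // mulr_ge0 ?ltW // divr_gt0.
  have -> : delta / 2 * l * (8 / delta) = 4 * l * (delta / delta) by lra.
  by rewrite mulfV ?gt_eqF //; lra.
have dl : 1 <= delta / 2 * l.
  have : delta / 2 * (2 / delta) <= delta / 2 * l.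
    by rewrite ler_wpM2l ?divr_ge0 ?ltW //; lra.
  have -> : delta / 2 * (2 / delta) = delta / delta by lra.
  by rewrite mulfV ?gt_eqF.
exists (Num.truncn (4 * l / ln l)).+1; split; first exact: truncnS_gt.
by have /andP[tl _] := truncn_itv q0; rewrite -natr1; lra.
Qed.

(* The error factor in choosable_of_preference is d^o(1), uniformly for m <= M. *)
Lemma error_factor_small (R : realType) (r M : nat) (kappa c : R) :
  0 < kappa -> 0 < c ->
  exists z delta l0 : R, [/\ 0 < z <= 1, 0 < delta & forall (lambda : R) (m l t : nat),
    l0 <= lambda -> (0 < m <= M)%N -> l%:R <= c * lambda -> t%:R <= delta * lambda ->
    r%:R * m%:R * (z ^- (m * t) * (1 + m%:R * z) ^+ l) <= expR (kappa * lambda)].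
Proof.
move=> k0 c0.
have M1 : 0 < M.+1%:R :> R by rewrite ltr0n.
(* z is chosen first, so that (1 + m z)^l costs at most kappa lambda / 4 in the exponent; then delta
   for z^-(m t), and the bound on lambda for r m. *)
pose z := Num.min 1 (kappa / (4 * M.+1%:R * c)).
have z0 : 0 < z by rewrite lt_min ltr01 divr_gt0 // !mulr_gt0.
have z1 : z <= 1 by rewrite ge_min lexx.
have zc : z * (4 * M.+1%:R * c) <= kappa.
  by rewrite -ler_pdivlMr ?mulr_gt0 // ge_min lexx orbT.
pose Z := - ln z.
have Z0 : 0 <= Z by rewrite oppr_ge0 ln_le0.
have zE : z = expR (- Z) by rewrite opprK lnK // posrE.
pose W := M.+1%:R * Z + 1.
have W0 : 0 < W by rewrite ltr_wpDl // mulr_ge0 // ltW.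
exists z, (kappa / (4 * W)), (4 * (r * M)%:R / kappa).
split; first by rewrite z0.
  by rewrite divr_gt0 // mulr_gt0.
move=> lambda m l t l0 /andP[m0 mM] lc tl.
have lam0 : 0 <= lambda by apply: le_trans l0; rewrite divr_ge0 ?mulr_ge0 // ltW.
have mM' : m%:R <= M.+1%:R :> R by rewrite ler_nat (leq_trans mM).
have e1 : r%:R * m%:R <= expR (kappa * lambda / 4).
  apply: le_trans (expR_ge1Dx _).
  have : (r * m)%:R <= (r * M)%:R :> R by rewrite ler_nat leq_mul2l mM orbT.
  by move: l0; rewrite ler_pdivrMr // natrM; lra.
have e2 : z ^- (m * t) <= expR (kappa * lambda / 4).
  rewrite zE -expRM_natl -expRN ler_expR mulrN opprK natrM.
  apply: (@le_trans _ _ (M.+1%:R * t%:R * Z)).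
    by rewrite ler_wpM2r // ler_wpM2r.
  have tW : t%:R * W <= kappa * lambda / 4.
    have : t%:R * W <= kappa / (4 * W) * lambda * W by rewrite ler_wpM2r // ltW.
    have -> : kappa / (4 * W) * lambda * W = kappa * lambda / 4 * (W / W).
      by rewrite invfM; lra.
    by rewrite mulfV ?mulr1 // gt_eqF.
  have : 0 <= t%:R :> R by rewrite ler0n.
  by move: tW; rewrite /W; lra.
have e3 : (1 + m%:R * z) ^+ l <= expR (kappa * lambda / 4).
  apply: (@le_trans _ _ (expR (l%:R * (m%:R * z)))).
    rewrite expRM_natl lerXn2r ?nnegrE ?expR_ge0 ?expR_ge1Dx //.
    by rewrite addr_ge0 // mulr_ge0 // ltW.
  rewrite ler_expR.
  apply: (@le_trans _ _ (c * lambda * (M.+1%:R * z))).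
    by rewrite ler_pM // ?mulr_ge0 ?(ltW z0) // ler_wpM2r // ltW.
  have : z * (4 * M.+1%:R * c) * lambda <= kappa * lambda by rewrite ler_wpM2r.
  lra.
apply: (@le_trans _ _ (expR (kappa * lambda / 4) * (expR (kappa * lambda / 4) * expR (kappa * lambda / 4)))).
  have g2 : 0 <= z ^- (m * t) by rewrite invr_ge0 exprn_ge0 // ltW.
  have g3 : 0 <= (1 + m%:R * z) ^+ l.
    by rewrite exprn_ge0 // addr_ge0 // mulr_ge0 // ltW.
  by rewrite !ler_pM ?mulr_ge0.
have : 0 <= kappa * lambda by rewrite mulr_ge0 // ltW.
by rewrite -!expRD ler_expR; lra.
Qed.

(** * The two bounds on the list chromatic number *)

Lemma chromatic_le (r n l : nat) (G : partite_hypergraph r n) :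
  (1 < r)%N -> choosable G l -> (list_chromatic_number G <= l)%N.
Proof. by move=> r1 cl; have [_] := list_chromatic_numberP G r1; apply. Qed.

(** The constants are uniform in alpha: u = -ln f(beta) stays between ln (3/2) and (r-1) ln r, and
    one M bounds the size of the orders for all beta. *)
Lemma chromatic_upper (R : realType) (r : nat) (eps : R) : (1 < r)%N -> 0 < eps ->
  exists2 d0 : R, 1 < d0 & forall (n : nat) (d : R) (G : partite_hypergraph r n),
    d0 <= d -> d <= n%:R ^+ r.-1 -> property_D G d ->
    (list_chromatic_number G)%:R <=
      (g_pref r (log_base n%:R d) + eps) * log_base r%:R d.
Proof.
move=> r1 eps0; have r0 := ltnW r1.
have rR : 1 < r%:R :> R by rewrite ltr1n.
have lr0 : 0 < ln r%:R :> R by exact: ln_gt0.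
have rp : 1 <= r.-1%:R :> R by rewrite ler1n -ltnS prednK.
pose u0 : R := ln (3 / 2); pose u1 : R := r.-1%:R * ln r%:R.
have u00 : 0 < u0 by apply: ln_gt0; lra.
have u10 : 0 < u1 by rewrite mulr_gt0 //; lra.
(* The excess eps raises l u above lambda by 4 eta lambda. Rounding l takes at most 2 eta lambda,
   and the rest pays for B and for the near-optimality of P. *)
pose eta := eps * u0 / (4 * ln r%:R).
have eta0 : 0 < eta by rewrite divr_gt0 // mulr_gt0.
have etaE : 4 * eta = eps * u0 / ln r%:R.
  by rewrite /eta invfM; lra.
pose c := 1 / u0 + eps / ln r%:R.
have c0 : 0 < c by rewrite addr_gt0 // divr_gt0.
have ec0 : 0 < eta / c by rewrite divr_gt0.
have C1 : 1 < expR (eta / c) by rewrite expR_gt1.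
have [M HM] := f_pref_uniform r1 C1.
pose kappa := eta / (2 * r.-1%:R).
have kappa0 : 0 < kappa by rewrite divr_gt0 // mulr_gt0 //; lra.
have kr : kappa * r.-1%:R = eta / 2.
  rewrite /kappa invfM mulrA -[X in X = _]mulrA mulVf ?mulr1 //; lra.
have [z [delta [la [z01 delta0 Hz]]]] := error_factor_small r M kappa0 c0.
(* The second term ensures m t < l, since l > lambda / u1. *)
pose delta' := Num.min delta ((2 * M.+1%:R * u1)^-1).
have Mu : 0 < 2 * M.+1%:R * u1 by apply: mulr_gt0 u10; rewrite mulr_gt0.
have delta'0 : 0 < delta' by rewrite lt_min delta0 invr_gt0.
have [lb lb1 Ht] := threshold_small delta'0.
pose lambda0 := Num.max (Num.max la lb) (u1 / (2 * eta)).
have lambda01 : 1 < lambda0 by rewrite !lt_max lb1 orbT.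
exists (expR lambda0); first by rewrite expR_gt1; lra.
move=> n d G d0d dn hD.
have d1 : 1 < d by apply: lt_le_trans d0d; rewrite expR_gt1; lra.
have d0 : 0 < d by lra.
have [n0 alpha0 alphar nE] := log_ratio_facts d1 dn.
set alpha := log_base n%:R d in alpha0 alphar nE *.
rewrite g_prefE //.
have [/andP[b0 br] lnbE] := beta_spec r1 alpha0 alphar.
set b := beta r alpha in b0 br lnbE *.
have /andP[uu0 uu1] := neg_ln_f_inf_bounds r1 br.
rewrite -/u0 in uu0; rewrite -/u1 in uu1.
set u := - ln (f_inf r b) in uu0 uu1 *.
have u_gt0 : 0 < u by apply: lt_le_trans uu0.
pose lambda := ln d.
have lam0 : lambda0 <= lambda by rewrite -[leLHS]expRK ler_ln ?posrE ?expR_gt0.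
have dE : d = expR lambda by rewrite lnK // posrE.
have [laL lbL] : la <= lambda /\ lb <= lambda.
  by split; apply: (le_trans _ lam0); rewrite !le_max lexx ?orbT.
have etaL : u1 <= 2 * eta * lambda.
  rewrite [leRHS]mulrC -ler_pdivrMr; last by rewrite mulr_gt0.
  apply: (le_trans _ lam0).
  by rewrite le_max lexx orbT.
have lpos : 0 < lambda by lra.
pose target := lambda / u + eps * lambda / ln r%:R.
have targetE : (ln r%:R / u + eps) * log_base r%:R d = target.
  rewrite /log_base -/lambda /target mulrDl.
  have -> : ln r%:R / u * (lambda / ln r%:R) = lambda / u * (ln r%:R / ln r%:R) by lra.
  by rewrite mulfV ?gt_eqF // mulr1 mulrA.
have target0 : 0 <= target by rewrite addr_ge0 ?divr_ge0 ?mulr_ge0 ?ltW.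
rewrite targetE; pose l := Num.truncn target.
have /andP[lt1 lt2] := truncn_itv target0; rewrite -/l -natr1 in lt1 lt2.
have lc : l%:R <= c * lambda.
  apply: (le_trans lt1); rewrite /target /c.
  have : lambda / u <= lambda / u0 by rewrite ler_pM2l // lef_pV2 // posrE.
  lra.
have lu : (1 + 2 * eta) * lambda <= l%:R * u.
  have : target * u <= (l%:R + 1) * u by rewrite ler_wpM2r // ltW.
  have -> : target * u = lambda * (u / u) + eps * lambda / ln r%:R * u.
    by rewrite /target; lra.
  rewrite mulfV ?gt_eqF // mulr1.
  have : eps * lambda / ln r%:R * u0 <= eps * lambda / ln r%:R * u.
    by rewrite ler_wpM2l // divr_ge0 ?mulr_ge0 ?ltW.
  have -> : eps * lambda / ln r%:R * u0 = 4 * eta * lambda by rewrite etaE; lra.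
  lra.
have [t [Kt tdelta]] := Ht _ lbL.
have tdelta1 : t%:R <= delta * lambda.
  by apply: (le_trans tdelta); rewrite ler_wpM2r ?(ltW lpos) // ge_min lexx.
have bb : 0 <= b <= r%:R^-1 by rewrite ltW.
have [m [P [mM hP fP]]] := HM b bb.
have Bge0 : 0 <= r%:R * m%:R * (z ^- (m * t) * (1 + m%:R * z) ^+ l).
  have z0 : 0 <= z by have /andP[/ltW] := z01.
  by rewrite !mulr_ge0 ?invr_ge0 ?exprn_ge0 ?addr_ge0 ?mulr_ge0.
have {}Hz := Hz _ _ _ _ laL mM lc tdelta1.
move: Hz Bge0; set B := (X in 0 <= X); move=> B_le B0.
have /andP[m0 mM'] := mM.
have f0 : 0 < f_inf r b.
  by apply: lt_le_trans (f_inf_lb r0 br); rewrite exprn_gt0 // invr_gt0 ltr0n.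
have fE : f_inf r b = expR (- u) by rewrite opprK lnK // posrE.
have bE : b = expR (- (u / alpha)).
  have -> : - (u / alpha) = ln b.
    by rewrite /u mulNr opprK lnbE mulrAC mulfV ?mul1r // gt_eqF.
  by rewrite lnK // posrE.
rewrite (le_trans _ lt1) // ler_nat; apply: chromatic_le => //.
have eL : 0 < eta * lambda by rewrite mulr_gt0.
apply: (choosable_of_preference (z := z) (theta := b) (t := t) r1 n0 d0 hD m0 hP z01).
- rewrite -(ltr_nat R) natrM.
  have lu1 : lambda < l%:R * u1.
    apply: (@lt_le_trans _ _ (l%:R * u)); last by rewrite ler_wpM2l.
    by apply: lt_le_trans lu; rewrite mulrDl mul1r ltrDl -mulrA pmulr_rgt0.
  have mt : m%:R * t%:R <= M.+1%:R * t%:R :> R.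
    by rewrite ler_wpM2r // ler_nat (leq_trans mM').
  apply: (le_lt_trans mt); rewrite -(ltr_pM2r u10); apply: le_lt_trans lu1.
  have td : t%:R <= (2 * M.+1%:R * u1)^-1 * lambda.
    by apply: (le_trans tdelta); rewrite ler_wpM2r ?(ltW lpos) // ge_min lexx orbT.
  have tMu : t%:R * (2 * M.+1%:R * u1) <= lambda.
    by rewrite -ler_pdivlMr // [leRHS]mulrC.
  have tMu0 : 0 <= t%:R * (M.+1%:R * u1) by rewrite mulr_ge0 // mulr_ge0 // ltW.
  move: tMu tMu0 lpos; clear; lra.
- by [].
- exact: ltW.
- apply: (@le_lt_trans _ _ (expR (kappa * lambda) * n%:R * b ^+ l)).
    by rewrite !ler_wpM2r // exprn_ge0 // ltW.
  rewrite nE bE -expRM_natl -!expRD expR_lt1 -/lambda.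
  have ila : 0 < alpha^-1 by rewrite invr_gt0.
  have h1 : (1 + 2 * eta) * lambda * alpha^-1 <= l%:R * u * alpha^-1.
    by rewrite ler_wpM2r // ltW.
  have h2 : kappa * lambda <= eta / 2 * lambda * alpha^-1.
    have : kappa * lambda * alpha <= kappa * lambda * r.-1%:R.
      by rewrite ler_wpM2l // mulr_ge0 ?ltW.
    have -> : kappa * lambda * r.-1%:R = eta / 2 * lambda by rewrite mulrAC kr.
    by rewrite -ler_pdivlMr.
  have h3 : 0 < eta * lambda * alpha^-1 by rewrite mulr_gt0.
  move: h1 h2 h3; clear; lra.
- rewrite dE -expRN.
  have CE : f_pref P b <= expR (eta / c - u) by rewrite expRB -expRN -fE.
  apply: (@le_lt_trans _ _ (expR (kappa * lambda) ^+ r.-1 * expR (eta / c - u) ^+ l)).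
    by apply: ler_pM; rewrite ?exprn_ge0 ?f_pref_ge0 // lerXn2r ?nnegrE ?expR_ge0 ?f_pref_ge0.
  rewrite -!expRM_natl -expRD ltr_expR.
  have -> : r.-1%:R * (kappa * lambda) = eta / 2 * lambda.
    by rewrite mulrA [_ * kappa]mulrC kr.
  have le_c : l%:R * (eta / c) <= eta * lambda.
    have -> : eta * lambda = c * lambda * (eta / c).
      by rewrite [c * lambda]mulrC -[RHS]mulrA [c * _]mulrC divfK ?gt_eqF // mulrC.
    by rewrite ler_wpM2r // ltW.
  move: le_c lu eL; clear; lra.
Qed.

Lemma chromatic_lower (R : realType) (r : nat) (eps : R) : (1 < r)%N -> 0 < eps ->
  exists2 d0 : R, 1 < d0 & forall (n : nat) (d : R) (G : partite_hypergraph r n),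
    d0 <= d -> d <= n%:R ^+ r.-1 -> property_I G d ->
    (g_pref r (log_base n%:R d) - eps) * log_base r%:R d <=
      (list_chromatic_number G)%:R.
Proof.
move=> r1 eps0; have r0 := ltnW r1.
have rR : 1 < r%:R :> R by rewrite ltr1n.
have rR0 : 0 < r%:R :> R by rewrite ltr0n.
have lr0 : 0 < ln r%:R :> R by exact: ln_gt0.
have rp : 0 < r.-1%:R :> R by rewrite ltr0n -ltnS prednK.
pose u0 : R := ln (3 / 2).
have u00 : 0 < u0 by apply: ln_gt0; lra.
pose eta := eps * u0 / ln r%:R.
have eta0 : 0 < eta by rewrite divr_gt0 // mulr_gt0.
pose q := (r ^ r.-1)%N.
have q0 : (0 < q)%N by rewrite expn_gt0 r0.
have qR : 0 < q%:R :> R by rewrite ltr0n.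
pose A : R := (2 / u0 ^+ 2 + 1) * q%:R.
have A0 : 0 <= A by rewrite mulr_ge0 // addr_ge0 // divr_ge0 // exprn_ge0 // ltW.
have e10 : 0 < eta / r.-1%:R by rewrite divr_gt0.
(* With the palette size M at most A lambda^2, the first bound handles the union over 2^M sets, the
   second the factor (8 M)^(r-1) ln^2 d. *)
have [l1 l11 H1] := expR_dominates 2 e10 (mulr_ge0 (ler0n R 8) (addr_ge0 (ler0n R r) A0)).
have [l2 l21 H2] := expR_dominates (2 * r.-1 + 2) eta0
  (exprn_ge0 r.-1 (mulr_ge0 (ler0n R 8) A0)).
pose lambda0 := Num.max l1 l2.
have lambda01 : 1 <= lambda0 by rewrite le_max l11.
exists (expR lambda0); first by rewrite expR_gt1 (lt_le_trans ltr01).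
move=> n d G d0d dn hI.
have d1 : 1 < d by apply: lt_le_trans d0d; rewrite expR_gt1 (lt_le_trans ltr01).
have d0 : 0 < d := lt_trans ltr01 d1.
have [n0 alpha0 alphar nE] := log_ratio_facts d1 dn.
set alpha := log_base n%:R d in alpha0 alphar nE *.
rewrite g_prefE //.
have [/andP[b0 br] lnbE] := beta_spec r1 alpha0 alphar.
set b := beta r alpha in b0 br lnbE *.
have /andP[uu0 _] := neg_ln_f_inf_bounds r1 br.
rewrite -/u0 in uu0.
set u := - ln (f_inf r b) in uu0 *.
have u_gt0 : 0 < u by apply: lt_le_trans uu0.
pose lambda := ln d.
have lam0 : lambda0 <= lambda by rewrite -[leLHS]expRK ler_ln ?posrE ?expR_gt0.
have dE : d = expR lambda by rewrite lnK // posrE.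
have lam1 : 1 <= lambda := le_trans lambda01 lam0.
have lpos : 0 < lambda := lt_le_trans ltr01 lam1.
have l1L : l1 <= lambda by apply: (le_trans _ lam0); rewrite le_max lexx.
have l2L : l2 <= lambda by apply: (le_trans _ lam0); rewrite le_max lexx orbT.
have {}H1 := H1 _ l1L; have {}H2 := H2 _ l2L.
set l := list_chromatic_number G.
rewrite leNgt; apply/negP => ltl.
have lu : l%:R * u <= (1 - eta) * lambda.
  have -> : (1 - eta) * lambda = ((ln r%:R / u0 - eps) * (lambda / ln r%:R)) * u0.
    have -> : (ln r%:R / u0 - eps) * (lambda / ln r%:R) * u0 =
      (ln r%:R / ln r%:R) * (u0 / u0) * lambda - eta * lambda.
      by rewrite /eta; move: (ln r%:R) (u0) => x y; lra.
    by rewrite !mulfV ?gt_eqF // !mul1r mulrBl mul1r.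
  have lr : l%:R * u <= (ln r%:R / u - eps) * (lambda / ln r%:R) * u.
    by rewrite ler_wpM2r ?(ltW u_gt0) // ltW.
  apply: (le_trans lr).
  have e x : 0 < x -> (ln r%:R / x - eps) * (lambda / ln r%:R) * x =
      lambda - eps * (lambda / ln r%:R) * x.
    move=> x0; rewrite mulrBl mulrBl; congr (_ - _).
    have -> : ln r%:R / x * (lambda / ln r%:R) * x =
      (ln r%:R / ln r%:R) * (x / x) * lambda by move: (ln r%:R) => y; lra.
    by rewrite !mulfV ?gt_eqF // !mul1r.
  rewrite !e // lerD2l lerN2 ler_wpM2l //.
  by rewrite mulr_ge0 ?(ltW eps0) // divr_ge0 // ltW.
have lle : l%:R <= lambda / u0.
  rewrite ler_pdivlMr //; apply: (@le_trans _ _ (l%:R * u)); first by rewrite ler_wpM2l.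
  by apply: (le_trans lu); rewrite ler_piMl ?(ltW lpos) // gerBl ltW.
pose e : R := r%:R^-1 ^+ r.-1.
have e0 : 0 < e by rewrite exprn_gt0 // invr_gt0.
have e1 : e <= 1 by rewrite exprn_ile1 ?invr_ge0 ?invf_le1 // ltW.
have eq1 : e * q%:R = 1.
  by rewrite /e /q natrX exprVn mulVf // gt_eqF // exprn_gt0.
(* Raising beta to at least e does not lower f, and lets a palette of order l^2 satisfy 2 l^2 <=
   theta M however small beta is. *)
pose theta := Num.max b e.
have theta0 : 0 < theta by rewrite lt_max b0.
have theta1 : theta <= 1.
  by rewrite ge_max e1 andbT (le_trans br) // invf_le1 // ltW.
have ftheta : f_inf r b <= f_inf r theta.
  by rewrite /theta; case: (leP b e) => _; [exact: (f_inf_flat r1 (ltW b0)) | exact: lexx].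
have ln_theta : - (u / alpha) <= ln theta.
  have -> : - (u / alpha) = ln b.
    by rewrite /u mulNr opprK lnbE mulrAC mulfV ?mul1r // gt_eqF.
  by rewrite ler_ln ?posrE // le_max lexx.
pose M := ((2 * (l * l) + 1) * q)%N.
have M0 : (0 < M)%N by rewrite muln_gt0 q0 addn1.
have MR : 0 < M%:R :> R by rewrite ltr0n.
have MA : M%:R <= A * lambda ^+ 2.
  rewrite /M natrM natrD natrM natrM /A [leRHS]mulrAC ler_wpM2r ?(ltW qR) //.
  have ll : l%:R * l%:R <= (lambda / u0) ^+ 2 by rewrite expr2 ler_pM.
  have lam2 : 1 <= lambda ^+ 2 by rewrite exprn_ege1.
  have E2 : (lambda / u0) ^+ 2 = lambda ^+ 2 / u0 ^+ 2 by rewrite expr_div_n.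
  rewrite E2 in ll; move: ll lam2; clear; move: (lambda ^+ 2) (u0 ^+ 2) => x y; lra.
have f0 : 0 < f_inf r b by apply: lt_le_trans (f_inf_lb r0 br).
have fE : f_inf r b = expR (- u) by rewrite opprK lnK // posrE.
(* n theta^l is at least exp((lambda - l u)/alpha); as l u <= (1 - eta) lambda and alpha <= r - 1, a
   fixed positive power of d remains. *)
have nth : expR (eta / r.-1%:R * lambda) <= n%:R * theta ^+ l.
  have -> : theta ^+ l = expR (l%:R * ln theta) by rewrite expRM_natl lnK // posrE.
  rewrite nE -expRD ler_expR -/lambda.
  have ila : 0 < alpha^-1 by rewrite invr_gt0.
  have h1 : l%:R * u * alpha^-1 <= (1 - eta) * lambda * alpha^-1.
    by rewrite ler_wpM2r // ltW.
  have h2 : l%:R * (- (u / alpha)) <= l%:R * ln theta by rewrite ler_wpM2l.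
  have h3 : eta / r.-1%:R * lambda <= eta * lambda * alpha^-1.
    rewrite [leLHS]mulrAC; apply: ler_wpM2l; last by rewrite lef_pV2 ?posrE.
    exact: mulr_ge0 (ltW eta0) (ltW lpos).
  move: h1 h2 h3; clear; lra.
have [cl _] := list_chromatic_numberP G r1.
apply: (not_choosable (theta := theta) (phi := f_inf r b) (M := M) r1 hI _ M0 _ _ f0 ftheta _ cl).
- by rewrite theta0.
- apply: (@le_trans _ _ (e * M%:R)); last by rewrite ler_wpM2r // le_max lexx orbT.
  by rewrite /M [(_ * q)%:R]natrM mulrCA eq1 mulr1 ler_nat leq_addr.
- have e2 : 2 <= expR 1 :> R := expR_ge1Dx 1.
  have re : r%:R <= expR r%:R :> R by apply: (le_trans _ (expR_ge1Dx _)); rewrite lerDr.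
  have Me : 2 ^+ M <= expR M%:R :> R.
    by rewrite -[M%:R]mulr1 expRM_natl lerXn2r ?nnegrE ?expR_ge0.
  apply: (@le_lt_trans _ _ (expR r%:R * expR M%:R * expR (- (n%:R * theta ^+ l / 8)))).
    by rewrite ler_wpM2r ?expR_ge0 // ler_pM.
  rewrite -!expRD expR_lt1.
  have rA : (8 * (r%:R + A)) * lambda ^+ 2 = 8 * (r%:R * lambda ^+ 2) + 8 * (A * lambda ^+ 2).
    by move: (lambda ^+ 2); clear => x; lra.
  have lam2 : 1 <= lambda ^+ 2 by rewrite exprn_ege1.
  have rl : r%:R <= r%:R * lambda ^+ 2 :> R by rewrite ler_peMr.
  rewrite rA in H1; move: H1 nth MA rl.
  by move: (expR _) (n%:R * _) (A * _) (r%:R * _); clear => *; lra.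
- have K0 : 0 < (8 * M%:R) ^+ r.-1 :> R by rewrite exprn_gt0 // mulr_gt0.
  have main : (8 * M%:R) ^+ r.-1 * lambda ^+ 2 <= expR (eta * lambda).
    apply: le_trans (ltW H2).
    rewrite [lambda ^+ (_ + _)]exprD mulrA [lambda ^+ (2 * _)]exprM -exprMn.
    rewrite ler_wpM2r ?exprn_ge0 ?(ltW lpos) //.
    have A8 := mulr_ge0 (mulr_ge0 (ler0n R 8) A0) (exprn_ge0 2 (ltW lpos)).
    by rewrite lerXn2r ?nnegrE // -[leRHS]mulrA ler_wpM2l.
  have -> : (n%:R / 8 / M%:R) ^+ r.-1 = n%:R ^+ r.-1 / (8 * M%:R) ^+ r.-1 :> R.
    by rewrite -expr_div_n invfM mulrA.
  rewrite -[leLHS]mulrA -[leRHS]mulrA ler_wpM2l ?exprn_ge0 // ler_pdivlMl //.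
  rewrite -/lambda mulrCA [leLHS]mulrC dE -expRN fE -expRM_natl.
  apply: (le_trans (ler_wpM2r (expR_ge0 _) main)); rewrite -expRD ler_expR.
  by move: lu; clear; lra.
Qed.

(** Makes the supremum defining the error finite at each d. The bound must not depend on n, so theta
    is 0, where n theta^l vanishes; an order with f_P(0) < 3/4 gives geometric decay in l. *)
Lemma chromatic_bounded (R : realType) (r : nat) (d : R) : (1 < r)%N -> 0 < d ->
  exists B : nat, forall (n : nat) (G : partite_hypergraph r n), (0 < n)%N ->
    property_D G d -> (list_chromatic_number G <= B)%N.
Proof.
move=> r1 d0; have r0 := ltnW r1.
have [m [P [m0 hP fP]]] : exists m (P : 'I_r -> rel 'I_m),
    [/\ (0 < m)%N, preference_order P & f_pref P (0 : R) < 3 / 4].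
  by apply: f_inf_approx; apply: le_lt_trans (f_inf_ub _ r1) _; lra.
have mR : 0 < m%:R :> R by rewrite ltr0n.
have [|b b0 hb] := @exists_root_le R (7 / 6) r.-1; first by lra.
have bR : 0 < b%:R :> R by rewrite ltr0n.
(* Then m z = 1/b, and the base of the decay is at most 7/6 times 3/4, that is 7/8. *)
pose z : R := (m%:R * b%:R)^-1.
have z0 : 0 < z by rewrite invr_gt0 mulr_gt0.
have z1 : z <= 1 by rewrite invf_le1 ?mulr_gt0 // -natrM ler1n muln_gt0 m0.
have mz : m%:R * z = b%:R^-1 by rewrite /z invfM mulrA mulfV ?mul1r // gt_eqF.
pose t := Num.bound `|4 * ln d / ln (ln d)|.
have tK : 4 * ln d / ln (ln d) < t%:R.
  exact: le_lt_trans (ler_norm _) (archi_boundP (normr_ge0 _)).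
pose W := (r%:R * m%:R * z ^- (m * t)) ^+ r.-1.
have W0 : 0 < W.
  by rewrite exprn_gt0 // mulr_gt0 ?invr_gt0 ?exprn_gt0 // mulr_gt0 // ltr0n.
have [j hj] : exists j, (7 / 8) ^+ j <= (2 * d * W)^-1 :> R.
  apply: exists_expr_le; first by apply/andP; split; lra.
  by rewrite invr_gt0; apply: mulr_gt0 W0; rewrite mulr_gt0.
pose l := (j + (m * t).+1)%N.
exists l => n G n0 hD; apply: chromatic_le => //.
have l0 : (0 < l)%N by rewrite /l addnS.
apply: (choosable_of_preference (z := z) (theta := 0) (t := t) r1 n0 d0 hD m0 hP) => //.
- by rewrite z0.
- by rewrite /l addnS ltnS leq_addl.
- by rewrite expr0n eqn0Ngt l0 mulr0.
rewrite mulrA exprMn mz -/W -mulrA -exprM mulnC exprM -exprMn.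
have base : (1 + b%:R^-1) ^+ r.-1 * f_pref P 0 <= 7 / 8 :> R.
  apply: (@le_trans _ _ (7 / 6 * (3 / 4))); last by lra.
  by apply: ler_pM; rewrite ?exprn_ge0 ?f_pref_ge0 // ltW.
have base0 : 0 <= (1 + b%:R^-1) ^+ r.-1 * f_pref P 0 :> R.
  by rewrite mulr_ge0 ?exprn_ge0 ?f_pref_ge0.
apply: (@le_lt_trans _ _ (W * (2 * d * W)^-1)).
  rewrite ler_wpM2l ?(ltW W0) //; apply: le_trans hj.
  apply: (@le_trans _ _ ((7 / 8) ^+ l)); first by rewrite lerXn2r ?nnegrE.
  by rewrite ler_wiXn2l ?leq_addr //; lra.
rewrite [(2 * d * W)^-1]invfM mulrCA mulfV ?gt_eqF // mulr1.
by rewrite ltf_pV2 ?posrE ?mulr_gt0 // ltr_pMl // ltr1n.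
Qed.

(** At d = 1 the bound in property I is zero, and the empty set violates it. *)
Lemma property_I_gt1 (R : realType) (r n : nat) (G : partite_hypergraph r n) (d : R) :
  (1 < r)%N -> 1 <= d -> property_I G d -> 1 < d.
Proof.
move=> r1 d1 hI; rewrite lt_neqAle d1 andbT eq_sym; apply/eqP => dE.
have ind : independent (finset.set0 : {set G}).
  move=> e eE; have [u ue _] := edge_vertex_class (Ordinal (ltnW r1)) eE.
  by apply/negP => /fintype.subsetP/(_ u ue); rewrite finset.in_set0.
have := hI _ ind; rewrite dE ln1 expr0n mulr0 ltNge => /negP[].
by apply: prod_but_max_ge0 => i; rewrite ler0n.
Qed.

(** * The error term *)

Local Open Scope classical_set_scope.
Local Open Scope ring_scope.

Theorem theorem1p5 (R : realType) (r : nat) (hr : (2 <= r)%N) :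
  exists err : R -> R,
    err d @[d --> +oo] --> (0 : R) /\
    forall (n : nat) (d : R) (G : partite_hypergraph r n),
      1 <= d -> d <= n%:R ^+ r.-1 ->
      property_I G d -> property_D G d ->
      exists2 o : R, `|o| <= err d &
        (list_chromatic_number G)%:R =
          (g_pref r (log_base n%:R d) + o) * log_base r%:R d.
Proof.
have lr0 : 0 < ln r%:R :> R by apply: ln_gt0; rewrite ltr1n.
pose dev (n : nat) (G : partite_hypergraph r n) (d : R) :=
  (list_chromatic_number G)%:R / log_base r%:R d - g_pref r (log_base n%:R d).
(* Taking the supremum over all n and G makes the error depend on r and d alone. *)
pose E (d : R) := [set x : R | exists n (G : partite_hypergraph r n),
  [/\ 1 < d, d <= n%:R ^+ r.-1, property_I G d, property_D G d & x = `|dev n G d|]].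
exists (fun d => sup (E d)); split.
  apply/cvgrPdist_le => eps eps0.
  have [d1 d11 H1] := chromatic_upper hr eps0.
  have [d2 d21 H2] := chromatic_lower hr eps0.
  near=> d.
  have d1d : d1 <= d by near: d; apply: nbhs_pinfty_ge; rewrite num_real.
  have d2d : d2 <= d by near: d; apply: nbhs_pinfty_ge; rewrite num_real.
  have Eeps x : E d x -> x <= eps.
    move=> [n [G [dgt dn hI hD ->]]].
    have ld : 0 < log_base r%:R d by rewrite divr_gt0 // ln_gt0.
    have up := H1 n d G d1d dn hD; have lo := H2 n d G d2d dn hI.
    rewrite /dev ler_norml; apply/andP; split.
      by rewrite lerBrDl ler_pdivlMr.
    by rewrite lerBlDr ler_pdivrMr // [eps + _]addrC.
  rewrite sub0r normrN.
  (* If no hypergraph qualifies for this d, the supremum is 0 by convention. *)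
  have [->|E0] := eqVneq (E d) set0; first by rewrite sup0 normr0 ltW.
  have /set0P[x Ex] := E0.
  rewrite ger0_norm; first by apply: ge_sup; [exists x | exact: Eeps].
  apply: (@le_trans _ _ x); first by have [n [G [_ _ _ _ ->]]] := Ex; exact: normr_ge0.
  by apply: ub_le_sup Ex; exists eps; exact: Eeps.
move=> n d G d1 dn hI hD; have dgt := property_I_gt1 hr d1 hI.
have ld : 0 < log_base r%:R d by rewrite divr_gt0 // ln_gt0.
have d0 : 0 < d := lt_trans ltr01 dgt.
exists (dev n G d); last by rewrite /dev subrKC divfK // gt_eqF.
apply: ub_le_sup; last by exists n, G.
(* The supremum dominates its members only if E d is bounded above, which is required for every d >
   1 and not just for large d. *)
have [B HB] := chromatic_bounded hr d0.
have u00 : 0 < ln (3 / 2) :> R by apply: ln_gt0; lra.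
exists (B%:R / log_base r%:R d + ln r%:R / ln (3 / 2)) => _ [k [H [_ dk _ hDH ->]]].
have [k0 a0 ar _] := log_ratio_facts dgt dk.
have /andP[_ br] := (beta_spec hr a0 ar).1.
have /andP[uu0 _] := neg_ln_f_inf_bounds hr br.
rewrite /dev; apply: (le_trans (ler_normB _ _)); rewrite !ger0_norm.
- apply: lerD; first by rewrite ler_wpM2r ?invr_ge0 ?(ltW ld) // ler_nat HB.
  rewrite g_prefE // ler_pM2l // lef_pV2 ?posrE //.
  exact: lt_le_trans uu0.
- by rewrite g_prefE // divr_ge0 ?(ltW lr0) // (le_trans (ltW u00)).
- by rewrite divr_ge0 // ltW.
Unshelve. all: by end_near.
Qed.
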